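(* Let $G\times M\to M$ be a left action of a Lie group $G$ on a manifold $M$, with matrix of infinitesimals $\Phi=\Phi(z)$ with respect to a basis $v_1,\dots,v_r$ of $\mathfrak g$. Let $z$ denote the coordinates on $M$, let $\xi$ denote the coordinates on $\mathfrak g^*$ associated to the same basis $v_1,\dots,v_r$, and let $\Lambda(\mathfrak g^* )$ be the structure matrix of the Lie Poisson bracket on $\mathfrak g^*$ in these coordinates. Then $$\{F,H\}=\begin{pmatrix}\nabla_zF^T&\nabla_\xi F^T\end{pmatrix}\begin{pmatrix}0&\Phi\\-\Phi^T&\Lambda(\mathfrak g^* )\end{pmatrix}\begin{pmatrix}\nabla_zH\\\nabla_\xi H\end{pmatrix}$$ is a Poisson bracket on $C^\infty(M\times\mathfrak g^*,\mathbb R)$. If instead the action is a right action, then $$\{F,H\}=\begin{pmatrix}\nabla_zF^T&\nabla_\xi F^T\end{pmatrix}\begin{pmatrix}0&-\Phi\\\Phi^T&\Lambda(\mathfrak g^* )\end{pmatrix}\begin{pmatrix}\nabla_zH\\\nabla_\xi H\end{pmatrix}$$ is a Poisson bracket on $C^\infty(M\times\mathfrak g^*,\mathbb R)$.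
   Context: Let $G$ be a Lie group of dimension $r$, with Lie algebra $\mathfrak g=T_eG$ and bracket $[v,w]=\frac{d}{dt}|_{t=0}\mathrm{Ad}(\exp(tv))w$ (for matrix groups, $[X,Y]=XY-YX$). A smooth map $(g,z)\mapsto g\cdot z$ is a left action if $h\cdot(g\cdot z)=(hg)\cdot z$ and a right action if $h\cdot(g\cdot z)=(gh)\cdot z$ (with $e\cdot z=z$). Everything is local: $M$ is taken to be an open subset of $\mathbb R^p$ with coordinates $z=(z^1,\dots,z^p)$. For a basis $v_1,\dots,v_r$ of $\mathfrak g$, the matrix of infinitesimals is the $p\times r$ matrix $\Phi(z)$ with entries $\Phi_{\ell k}(z)=\frac{d}{dt}|_{t=0}(\exp(tv_k)\cdot z)^\ell$, so that the infinitesimal vector field $X_k(z)=\frac{d}{dt}|_{t=0}\exp(tv_k)\cdot z$ equals $\sum_\ell\Phi_{\ell k}\partial_{z^\ell}$. The associated coordinates $\xi=(\xi_1,\dots,\xi_r)$ on $\mathfrak g^*$ are $\xi_i(\theta)=\theta(v_i)$ for $\theta\in\mathfrak g^*$. If $[v_i,v_j]=\sum_kc_{ij}^kv_k$, the Lie Poisson structure matrix $\Lambda(\mathfrak g^* )$ is the $r\times r$ matrix with entries $\{\xi_i,\xi_j\}=\sum_kc_{ij}^k\xi_k$. A Poisson bracket on the smooth real functions of a manifold is an $\mathbb R$-bilinear skew-symmetric operation satisfying the Jacobi identity and the Leibniz identity $\{F,GH\}=\{F,G\}H+G\{F,H\}$. *)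

(* Defs.v *)
From HB Require Import structures.
From mathcomp Require Import all_boot all_order all_algebra.
From mathcomp Require Import all_classical all_reals all_analysis.

Set Implicit Arguments.
Unset Strict Implicit.
Unset Printing Implicit Defensive.

Import Order.TTheory GRing.Theory Num.Theory.
Import numFieldNormedType.Exports.

Local Open Scope classical_set_scope.
Local Open Scope ring_scope.

Section Smooth.
Context {R : realType} {V W : normedModType R}.

(* Only used for V finite dimensional and U open: there f is of class C^(n+1)
   on U iff it is differentiable on U and all its directional derivatives are
   of class C^n on U. *)
Fixpoint class_C (n : nat) (U : set V) (f : V -> W) : Prop :=
  if n is n'.+1 then
    (forall x, U x -> differentiable f x) /\
    (forall v : V, class_C n' U ('D_v f))
  else forall x, U x -> {for x, continuous f}.

Definition smooth_on (U : set V) (f : V -> W) : Prop :=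
  forall n, class_C n U f.

End Smooth.

Record chart (R : realType) (r : nat) (T : topologicalType) := Chart {
  chart_dom : set T;
  chart_img : set 'rV[R]_r;
  chart_map : T -> 'rV[R]_r;
  chart_inv : 'rV[R]_r -> T;
  chart_dom_open : open chart_dom;
  chart_img_open : open chart_img;
  chart_map_img : forall g, chart_dom g -> chart_img (chart_map g);
  chart_inv_dom : forall x, chart_img x -> chart_dom (chart_inv x);
  chart_mapK : forall g, chart_dom g -> chart_inv (chart_map g) = g;
  chart_invK : forall x, chart_img x -> chart_map (chart_inv x) = x;
  chart_map_continuous :
    forall g, chart_dom g -> {for g, continuous chart_map};
  chart_inv_continuous :
    forall x, chart_img x -> {for x, continuous chart_inv} }.

HB.mixin Record isLieGroup (R : realType) (r : nat) G
    of Group G & Topological G := {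
  lie_hausdorff : hausdorff_space G;
  lie_second_countable : @second_countable G;
  atlas : set (chart R r G);
  atlas_cover : forall g : G, exists2 a, atlas a & chart_dom a g;
  atlas_compatible : forall a b, atlas a -> atlas b ->
    smooth_on [set x | chart_img a x /\ chart_dom b (chart_inv a x)]
      (fun x => chart_map b (chart_inv a x));
  lie_mul_continuous : continuous (fun gh : G * G => (gh.1 * gh.2)%g);
  lie_mul_smooth : forall a b c, atlas a -> atlas b -> atlas c ->
    smooth_on
      [set xy : 'rV[R]_r * 'rV[R]_r | [/\ chart_img a xy.1, chart_img b xy.2
         & chart_dom c (chart_inv a xy.1 * chart_inv b xy.2)%g]]
      (fun xy => chart_map c (chart_inv a xy.1 * chart_inv b xy.2)%g);
  lie_inv_continuous : continuous (fun g : G => (g^-1)%g);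
  lie_inv_smooth : forall a b, atlas a -> atlas b ->
    smooth_on [set x | chart_img a x /\ chart_dom b (chart_inv a x)^-1%g]
      (fun x => chart_map b (chart_inv a x)^-1%g) }.

#[short(type="lieGroupType")]
HB.structure Definition LieGroup (R : realType) (r : nat) :=
  {G of isLieGroup R r G & Group G & Topological G}.

(* The Lie algebra T_e G is identified with 'rV[R]_r by means of a chart c of
   the atlas around the unit: the tangent vector of a curve gamma through the
   unit is the derivative of chart_map c \o gamma. *)
Section LieAlgebra.
Context {R : realType} {r : nat} {G : lieGroupType R r}.

Definition chart_at_unit (c : chart R r G) : Prop :=
  atlas c /\ chart_dom c 1%g.

(* For every v, the map t |-> exp (t v) is the (unique) one-parameter subgroup
   with initial velocity v. *)
Definition is_exponential (c : chart R r G) (exp : 'rV[R]_r -> G) : Prop :=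
  forall v : 'rV[R]_r,
  [/\ forall s t : R, exp ((s + t) *: v) = (exp (s *: v) * exp (t *: v))%g,
      continuous (fun t : R => exp (t *: v)),
      forall a, atlas a ->
        smooth_on [set t : R | chart_dom a (exp (t *: v))]
          (fun t : R => chart_map a (exp (t *: v)))
    & is_derive (0 : R) 1 (fun t : R => chart_map c (exp (t *: v))) v].

(* The differential at the unit of the conjugation h |-> g h g^-1. *)
Definition Ad (c : chart R r G) (g : G) (w : 'rV[R]_r) : 'rV[R]_r :=
  'D_w (fun x => chart_map c (g * chart_inv c x * g^-1)%g)
    (chart_map c 1%g).

Definition lie_bracket (c : chart R r G) (exp : 'rV[R]_r -> G)
    (v w : 'rV[R]_r) : 'rV[R]_r :=
  derive1 (fun t : R => Ad c (exp (t *: v)) w) 0.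

End LieAlgebra.

Section Action.
Context {R : realType} {r p : nat} {G : lieGroupType R r}.
Implicit Types (M : set 'rV[R]_p) (act : G -> 'rV[R]_p -> 'rV[R]_p).

Definition smooth_action M act : Prop :=
  forall a, atlas a ->
    smooth_on (chart_img a `*` M)
      (fun xz : 'rV[R]_r * 'rV[R]_p => act (chart_inv a xz.1) xz.2).

Definition left_action M act : Prop :=
  [/\ forall g z, M z -> M (act g z),
      smooth_action M act,
      forall z, M z -> act 1%g z = z
    & forall h g z, M z -> act h (act g z) = act (h * g)%g z].

Definition right_action M act : Prop :=
  [/\ forall g z, M z -> M (act g z),
      smooth_action M act,
      forall z, M z -> act 1%g z = z
    & forall h g z, M z -> act h (act g z) = act (g * h)%g z].

Definition infinitesimals (exp : 'rV[R]_r -> G) act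
    (v : r.-tuple 'rV[R]_r) (z : 'rV[R]_p) : 'M[R]_(p, r) :=
  \matrix_(l < p, k < r) derive1 (fun t : R => act (exp (t *: tnth v k)) z 0 l) 0.

End Action.

Notation lie_dual R r := ('Hom('rV[R]_r, R^o)).

Section DualCoordinates.
Context {R : realType} {r : nat}.
Context (v : r.-tuple 'rV[R]_r).

Definition dual_coords (theta : lie_dual R r) : 'rV[R]_r :=
  \row_(i < r) theta (tnth v i).

Definition dual_of_coords (xi : 'rV[R]_r) : lie_dual R r :=
  linfun (fun w : 'rV[R]_r => \sum_(i < r) xi 0 i * coord v i w : R^o).

Lemma dual_of_coordsE xi w :
  dual_of_coords xi w = \sum_(i < r) xi 0 i * coord v i w.
Proof.
have lin : linear (fun w : 'rV[R]_r =>
    \sum_(i < r) xi 0 i * coord v i w : R^o).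
  move=> a x y; rewrite scaler_sumr -big_split; apply: eq_bigr => i _ /=.
  by rewrite linearP mulrDr /= mulrCA.
pose f : {linear 'rV[R]_r -> R^o} :=
  HB.pack (fun w : 'rV[R]_r => \sum_(i < r) xi 0 i * coord v i w : R^o)
    (GRing.isLinear.Build _ _ _ _ _ lin).
exact: (lfunE f w).
Qed.

Lemma dual_coordsK : basis_of fullv v -> cancel dual_coords dual_of_coords.
Proof.
move=> hv theta; apply/lfunP => w; rewrite dual_of_coordsE.
rewrite [in RHS](coord_basis hv (memvf w)) linear_sum.
apply: eq_bigr => i _; rewrite mxE linearZ /= (tnth_nth 0).
by rewrite mulrC.
Qed.

Lemma dual_of_coordsK : basis_of fullv v -> cancel dual_of_coords dual_coords.
Proof.
move=> hv xi; apply/rowP => j; rewrite mxE dual_of_coordsE (bigD1 j) //=.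
rewrite (tnth_nth 0) coord_free ?(basis_free hv) // eqxx mulr1 big1 ?addr0 //.
move=> i ij; rewrite coord_free ?(basis_free hv) //.
by rewrite eq_sym (negbTE ij) mulr0.
Qed.

End DualCoordinates.

Section PhaseSpace.
Context {R : realType} {r p : nat}.
Context (v : r.-tuple 'rV[R]_r).
Implicit Type F : 'rV[R]_p * lie_dual R r -> R.

Definition in_coords F (zxi : 'rV[R]_p * 'rV[R]_r) : R :=
  F (zxi.1, dual_of_coords v zxi.2).

Definition smooth_functions (M : set 'rV[R]_p) :
    set ('rV[R]_p * lie_dual R r -> R) :=
  [set F | smooth_on (M `*` [set: 'rV[R]_r]) (in_coords F)].

Definition grad_z F (x : 'rV[R]_p * lie_dual R r) : 'cV[R]_p :=
  \col_(l < p) 'D_(delta_mx 0 l, 0) (in_coords F) (x.1, dual_coords v x.2).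

Definition grad_xi F (x : 'rV[R]_p * lie_dual R r) : 'cV[R]_r :=
  \col_(k < r) 'D_(0, delta_mx 0 k) (in_coords F) (x.1, dual_coords v x.2).

End PhaseSpace.

Definition lie_poisson_matrix (R : realType) (r : nat) (G : lieGroupType R r)
    (c : chart R r G) (exp : 'rV[R]_r -> G) (v : r.-tuple 'rV[R]_r)
    (theta : lie_dual R r) : 'M[R]_r :=
  \matrix_(i < r, j < r)
    \sum_(k < r) coord v k (lie_bracket c exp (tnth v i) (tnth v j))
                 * dual_coords v theta 0 k.

Definition matrix_bracket (R : realType) (r p : nat)
    (v : r.-tuple 'rV[R]_r)
    (S : 'rV[R]_p * lie_dual R r -> 'M[R]_(p + r))
    (F H : 'rV[R]_p * lie_dual R r -> R) (x : 'rV[R]_p * lie_dual R r) : R :=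
  (row_mx (grad_z v F x)^T (grad_xi v F x)^T *m S x
     *m col_mx (grad_z v H x) (grad_xi v H x)) 0 0.

(* Functions on D are represented by total functions whose values outside D
   are irrelevant. *)
Record is_poisson_bracket (R : realType) (T : Type) (D : set T)
    (C : set (T -> R)) (br : (T -> R) -> (T -> R) -> (T -> R)) : Prop := {
  poisson_closed : forall F H, C F -> C H -> C (br F H);
  poisson_ext : forall F F' H H', C F -> C F' -> C H -> C H' ->
    (forall x, D x -> F x = F' x) -> (forall x, D x -> H x = H' x) ->
    forall x, D x -> br F H x = br F' H' x;
  poisson_linearl : forall (a : R) F K H, C F -> C K -> C H -> forall x, D x ->
    br (fun y => a * F y + K y) H x = a * br F H x + br K H x;
  poisson_linearr : forall (a : R) F H K, C F -> C H -> C K -> forall x, D x ->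
    br F (fun y => a * H y + K y) x = a * br F H x + br F K x;
  poisson_skew : forall F H, C F -> C H -> forall x, D x ->
    br F H x = - br H F x;
  poisson_jacobi : forall F H K, C F -> C H -> C K -> forall x, D x ->
    br F (br H K) x + br H (br K F) x + br K (br F H) x = 0;
  poisson_leibniz : forall F H K, C F -> C H -> C K -> forall x, D x ->
    br F (fun y => H y * K y) x = br F H x * K x + H x * br F K x }.

(* Main.v *)
Require Import Defs.
From HB Require Import structures.
From mathcomp Require Import all_boot all_order all_algebra.
From mathcomp Require Import all_classical all_reals all_analysis.
From mathcomp Require Import ring.
Import Order.TTheory GRing.Theory Num.Theory.
Import numFieldNormedType.Exports.
Local Open Scope classical_set_scope.
Local Open Scope ring_scope.

Set Implicit Arguments.
Unset Strict Implicit.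
Unset Printing Implicit Defensive.

(** Everything happens in the chart c at the unit. Let mu be the group law read
in c, x0 the image of the unit, and B(v, w) the mixed second derivative of mu
at (x0, x0), in the direction v of the first variable and w of the second.

For a left action A(x, z), let T_v f (z) be the derivative of f o A at (x0, z)
in the direction (v, 0), so that T_v is the infinitesimal vector field of v.
Differentiating f(A(x, A(y, z))) = f(A(mu(x, y), z)) in y, then in x, gives
  T_w (T_v f) = D_v D_w (f o A) + T_(B(v, w)) f,
and hence, by the symmetry of second derivatives,
  T_w T_v - T_v T_w = T_(b(v, w)) with b(v, w) = B(v, w) - B(w, v).
A right action is a left action of the opposite law, for which b changes sign.
Differentiating g x g^-1 = mu(mu(g, x), g^-1) along g = exp (t v) shows that b
is the Lie bracket. Applied to the action of the group on itself, the
commutator formula reduces the Jacobi identity of b to that of commutators of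
operators.

Finally, a bracket with a skew structure matrix S satisfies the Jacobi identity
as soon as the coordinate functions do, because the terms with second
derivatives cancel in the cyclic sum. For the matrix S of the theorem the
coordinate identities are the Jacobi identity of b and the commutator
formula. *)

(** * Calculus of maps of class C^n on open sets *)

Section ClassC.
Context {R : realType}.
Implicit Types V W : normedModType R.

(** The first-order expansion of [f] at [x] is also one of [g], and uniqueness of the differential
    turns it into differentiability of [g]. *)
Lemma near_eq_differentiable V W (f g : V -> W) (x : V) :
  (\near x, f x = g x) -> differentiable f x -> differentiable g x.
Proof.
move=> fg df; have [cdf ef] := (diff_locallyP x f).1 df.
have eg : g \o shift x = cst (g x) + 'd f x +o_ 0 id.
  apply/eqaddoP => e e0; have /eqaddoP/(_ _ e0) ef' := ef.
  have fg0 : \forall h \near 0, f (h + x) = g (h + x).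
    by move: fg; rewrite (near_shift 0) subr0.
  near=> h.
  have -> : (g \o shift x - (cst (g x) + 'd f x)) h =
      (f \o shift x - (cst (f x) + 'd f x)) h.
    rewrite /GRing.add /GRing.opp /= /GRing.add /=.
    by rewrite (nbhs_singleton fg) (near fg0 h).
  by near: h.
by apply/diff_locallyP; rewrite (diff_unique cdf eg).
Unshelve. all: by end_near. Qed.

Lemma open_near_eq V W (U : set V) (f g : V -> W) x : open U ->
  {in U, f =1 g} -> U x -> \near x, f x = g x.
Proof.
move=> oU fg Ux; near=> y; apply: fg; rewrite inE; near: y.
exact: open_nbhs_nbhs.
Unshelve. all: by end_near. Qed.

Lemma open_eq_derive V W (U : set V) (f g : V -> W) x v : open U ->
  {in U, f =1 g} -> U x -> 'D_v f x = 'D_v g x.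
Proof.
by move=> oU fg Ux; apply: near_eq_derive; exact: open_near_eq Ux.
Qed.

(** Since [U] is open, derivatives at its points depend only on the values on [U], so the agreement
    passes to the directional derivatives and the induction goes through. *)
Lemma class_C_ext V W n (U : set V) (f g : V -> W) : open U ->
  {in U, f =1 g} -> class_C n U f -> class_C n U g.
Proof.
move=> oU; elim: n f g => [|n IH] f g fg /=.
  move=> cf x Ux; have cfx : f y @[y --> x] --> f x := cf x Ux.
  rewrite /prop_for /continuous_at -(fg x) ?inE//.
  apply: cvg_trans cfx; apply: near_eq_cvg.
  by apply: (open_near_eq oU _ Ux) => y yU; rewrite fg.
move=> [df Df]; split=> [x Ux|v].
  by apply: near_eq_differentiable (df x Ux); exact: open_near_eq Ux.
apply: IH (Df v) => x; rewrite inE => Ux.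
exact: open_eq_derive fg Ux.
Qed.

Lemma class_C_sub V W n (U U' : set V) (f : V -> W) : U' `<=` U ->
  class_C n U f -> class_C n U' f.
Proof.
move=> UU'; elim: n f => [|n IH] f /=; first by move=> cf x /UU' /cf.
by move=> [df Df]; split=> [x /UU' /df//|v]; exact: IH.
Qed.

Lemma class_C_pred V W n (U : set V) (f : V -> W) :
  class_C n.+1 U f -> class_C n U f.
Proof.
elim: n f => [|n IH] f /=.
  by move=> [df _] x Ux; exact/differentiable_continuous/df.
by move=> [df Df]; split=> [//|v]; exact/IH/Df.
Qed.

Lemma class_C_cst V W n (U : set V) (a : W) : class_C n U (cst a : V -> W).
Proof.
elim: n a => [|n IH] a /=; first by move=> x _; exact: cvg_cst.
split=> [x _|v]; first exact: differentiable_cst.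
rewrite (_ : 'D_v _ = cst 0) //.
by apply/funext => x; rewrite derive_cst.
Qed.

Lemma class_C_add V W n (U : set V) (f g : V -> W) : open U ->
  class_C n U f -> class_C n U g -> class_C n U (fun x => f x + g x).
Proof.
move=> oU; elim: n f g => [|n IH] f g /=.
  by move=> cf cg x Ux; apply: cvgD; [exact: cf|exact: cg].
move=> [df Df] [dg Dg]; split=> [x Ux|v].
  by apply: differentiableD; [exact: df|exact: dg].
apply: class_C_ext (IH _ _ (Df v) (Dg v)) => // x; rewrite inE => Ux.
by rewrite -deriveD//; apply: diff_derivable; [exact: df|exact: dg].
Qed.

Lemma class_C_mul V n (U : set V) (f g : V -> R) : open U ->
  class_C n U f -> class_C n U g -> class_C n U (fun x => f x * g x).
Proof.
move=> oU; elim: n f g => [|n IH] f g.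
  by move=> cf cg x Ux; apply: cvgM; [exact: cf|exact: cg].
move=> Cf Cg; have [df Df] := Cf; have [dg Dg] := Cg; split=> [x Ux|v].
  by apply: differentiableM; [exact: df|exact: dg].
(* The product rule keeps one factor undifferentiated, which enters the induction hypothesis with
   its class lowered by one. *)
have := class_C_add oU (IH _ _ (class_C_pred Cf) (Dg v))
  (IH _ _ (class_C_pred Cg) (Df v)).
apply: class_C_ext => // x; rewrite inE => Ux.
by rewrite -deriveM//; apply: diff_derivable; [exact: df|exact: dg].
Qed.

Lemma class_C_sum V n (U : set V) (I : Type) (s : seq I) (P : pred I)
    (f : I -> V -> R) : open U -> (forall i, P i -> class_C n U (f i)) ->
  class_C n U (fun x => \sum_(i <- s | P i) f i x).
Proof.
move=> oU Cf; elim: s => [|i s IH].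
  rewrite (_ : (fun x => _) = cst 0); first exact: class_C_cst.
  by apply/funext => x; rewrite big_nil.
rewrite (_ : (fun x => _) = if P i then
  fun x => f i x + \sum_(i <- s | P i) f i x else
  fun x => \sum_(i <- s | P i) f i x); last first.
  by apply/funext => x; rewrite big_cons; case: ifP.
by case: ifP => // Pi; apply: class_C_add => //; exact: Cf.
Qed.

(** The two difference quotients are the same function of [h], so the equality holds even at points
    where the limit is a default value. Derivatives can thus be compared as functions on the whole
    space. *)
Lemma derive_precomp V V' W (g : V' -> V) (f : V -> W) x v u :
  (forall h : R, g (h *: v + x) = h *: u + g x) ->
  'D_v (fun y => f (g y)) x = 'D_u f (g x).
Proof.
move=> gE; rewrite /derive; set F := fun h : R => _; set G := fun h : R => _.
suff -> : F = G by [].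
by apply/funext => h; rewrite /F /G /= gE.
Qed.

(** The map [g] is affine: a step along [v] becomes a step along a fixed [u]. A derivative of the
    composite is then a derivative of [f] composed with the same [g]. This covers slices,
    projections and the exchange of variables. *)
Lemma class_C_precomp V V' W n (U : set V) (U' : set V') (g : V' -> V)
    (f : V -> W) : (forall x, differentiable g x) ->
  (forall v, exists u, forall (h : R) x, g (h *: v + x) = h *: u + g x) ->
  (forall x, U' x -> U (g x)) ->
  class_C n U f -> class_C n U' (fun x => f (g x)).
Proof.
move=> dg gE UU'; elim: n f => [|n IH] f /=.
  move=> cf x U'x; apply: (@continuous_comp _ _ _ g f).
    exact: differentiable_continuous.
  by apply: cf; exact: UU'.
move=> [df Df]; split=> [x U'x|v].
  by apply: (@differentiable_comp _ _ _ _ g f) => //; exact/df/UU'.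
have [u gu] := gE v.
rewrite (_ : 'D_v _ = fun x => 'D_u f (g x)); first exact: IH (Df u).
by apply/funext => x; exact: derive_precomp.
Qed.

Lemma derive_coord V m (f : V -> 'rV[R]_m) x v i : differentiable f x ->
  'D_v (fun y => f y 0 i) x = 'D_v f x 0 i.
Proof.
move=> df; rewrite derive_mx ?mxE//; exact: diff_derivable.
Qed.

Lemma class_C_coord V m n (U : set V) (f : V -> 'rV[R]_m) i : open U ->
  class_C n U f -> class_C n U (fun x => f x 0 i).
Proof.
move=> oU; elim: n f => [|n IH] f /=.
  move=> cf x Ux; apply: (@continuous_comp _ _ _ f (fun A : 'rV[R]_m => A 0 i)).
    exact: cf.
  exact: coord_continuous.
move=> [df Df]; split=> [x Ux|v].
  apply: (@differentiable_comp _ _ _ _ f (fun A : 'rV[R]_m => A 0 i)).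
    exact: df.
  exact: differentiable_coord.
apply: class_C_ext (IH _ (Df v)) => // x; rewrite inE => Ux.
by rewrite derive_coord//; exact: df.
Qed.

Lemma derive_comp V' V W (g : V' -> V) (f : V -> W) x u : differentiable g x ->
  differentiable f (g x) -> 'D_u (fun y => f (g y)) x = 'D_('D_u g x) f (g x).
Proof.
move=> dg df; rewrite !deriveE //; last exact: differentiable_comp.
by rewrite diff_comp.
Qed.

Lemma derive_sum_dir V W (f : V -> W) x (I : finType) (a : I -> R) (e : I -> V) :
  differentiable f x ->
  'D_(\sum_i a i *: e i) f x = \sum_i a i *: 'D_(e i) f x.
Proof.
move=> df; rewrite deriveE // linear_sum; apply: eq_bigr => i _.
by rewrite linearZ /= deriveE.
Qed.

(** The chain rule with constant directions: all dependence of the direction on [x] sits in scalar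
    coefficients, so the formula can be differentiated again. *)
Lemma derive_comp_coord V W m (g : V -> 'rV[R]_m) (f : 'rV[R]_m -> W) x u :
  differentiable g x -> differentiable f (g x) ->
  'D_u (fun y => f (g y)) x =
  \sum_i ('D_u g x 0 i) *: 'D_(delta_mx 0 i) f (g x).
Proof.
move=> dg df; rewrite derive_comp // -derive_sum_dir //.
by rewrite -row_sum_delta.
Qed.

(** By the chain rule in coordinates, a derivative of the composite is a sum of products of
    coordinates of ['D_v g] with derivatives of [f] composed with [g], to which the induction
    hypothesis applies. *)
Lemma class_C_comp V m n (U : set V) (U' : set 'rV[R]_m)
    (g : V -> 'rV[R]_m) (f : 'rV[R]_m -> R) : open U ->
  (forall x, U x -> U' (g x)) ->
  class_C n U g -> class_C n U' f -> class_C n U (fun x => f (g x)).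
Proof.
move=> oU UU'; elim: n f => [|n IH] f.
  move=> cg cf x Ux; apply: (@continuous_comp _ _ _ g f); first exact: cg.
  by apply: cf; exact: UU'.
move=> Cg [df Df]; have [dg Dg] := Cg; split=> [x Ux|v].
  by apply: (@differentiable_comp _ _ _ _ g f); [exact: dg|exact/df/UU'].
have : class_C n U (fun x => \sum_i ('D_v g x 0 i) *
    'D_(delta_mx 0 i) f (g x)).
  apply: class_C_sum => // i _; apply: class_C_mul => //.
    exact: class_C_coord (Dg v).
  by apply: IH (Df _); exact: class_C_pred.
apply: class_C_ext => // x; rewrite inE => Ux.
by rewrite derive_comp_coord//; [exact: dg|exact/df/UU'].
Qed.

End ClassC.

(** * Symmetry of second derivatives *)

Section Schwarz.
Context {R : realType} {V : normedModType R}.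

Lemma is_derive_line (f : V -> R) (x v : V) (t : R) :
  differentiable f (x + t *: v) ->
  is_derive t 1 (fun s : R => f (x + s *: v)) ('D_v f (x + t *: v)).
Proof.
move=> df.
have dg : differentiable (fun s : R => x + s *: v) t.
  apply: (@differentiableD _ _ _ (cst x) (fun s : R => s *: v)).
    exact: differentiable_cst.
  exact: differentiableZl.
have dfg : differentiable (fun s : R => f (x + s *: v)) t.
  exact: (@differentiable_comp _ _ _ _ (fun s : R => x + s *: v) f).
apply: DeriveDef; first exact: diff_derivable.
rewrite (@derive_comp _ _ _ _ (fun s : R => x + s *: v) f) //; congr ('D_ _ f _).
rewrite (@deriveD _ _ _ (cst x) (fun s : R => s *: v)); last 2 first.
- exact: derivable_cst.
- by apply: diff_derivable; exact: differentiableZl.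
rewrite derive_cst add0r deriveE; last exact: differentiableZl.
by rewrite (@diffZl _ _ _ (id : R -> R)) // diff_val scale1r.
Qed.

Lemma MVT_line (f : V -> R) (x v : V) (e : R) : 0 < e ->
  (forall t, 0 <= t <= e -> differentiable f (x + t *: v)) ->
  exists2 t, 0 <= t <= e & f (x + e *: v) - f x = e * 'D_v f (x + t *: v).
Proof.
move=> e0 df.
have [| |t tI] := @MVT_segment R (fun s => f (x + s *: v))
  (fun s => 'D_v f (x + s *: v)) 0 e (ltW e0).
- move=> t; rewrite in_itv/= => /andP[t0 te].
  by apply: is_derive_line; apply: df; rewrite !ltW.
- apply: derivable_within_continuous => t; rewrite in_itv/= => /df dft.
  by have [] := is_derive_line dft.
- rewrite scale0r addr0 subr0 mulrC => ->; exists t; rewrite // -in_itv.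
Qed.

(** The mean value theorem is applied twice. The second difference is the increment along [e *: u]
    of [g], the increment of [f] along [e *: v]. The derivative of [g] along [u] is in turn an
    increment of ['D_u f] along [e *: v]. *)
Lemma second_difference (U : set V) (f : V -> R) (x u v : V) (e : R) : 0 < e ->
  class_C 2 U f ->
  (forall s t, 0 <= s <= e -> 0 <= t <= e -> U (x + s *: u + t *: v)) ->
  exists2 st : R * R, (0 <= st.1 <= e) && (0 <= st.2 <= e) &
    f (x + e *: u + e *: v) - f (x + e *: u) - f (x + e *: v) + f x =
    e * e * 'D_v ('D_u f) (x + st.1 *: u + st.2 *: v).
Proof.
move=> e0 [df D1] UU; have [D1f _] := D1 u.
have e0e : 0 <= e <= e by rewrite lexx ltW.
have e00 : 0 <= (0:R) <= e by rewrite lexx ltW.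
pose g y := f (y + e *: v) - f y.
have dfs s t : 0 <= s <= e -> 0 <= t <= e ->
    differentiable f (x + s *: u + t *: v).
  by move=> sI tI; apply: df; apply: UU.
have dsh s : 0 <= s <= e ->
    differentiable (fun y => f (y + e *: v)) (x + s *: u).
  move=> sI; apply: (@differentiable_comp _ _ _ _ (fun y => y + e *: v) f).
    by apply: (@differentiableD _ _ _ id (cst (e *: v))).
  exact: dfs.
have df0 s : 0 <= s <= e -> differentiable f (x + s *: u).
  by move=> /dfs /(_ e00); rewrite scale0r addr0.
have [|s sI gE] := @MVT_line g x u e e0.
  move=> s sI; apply: (@differentiableB _ _ _ (fun y => f (y + e *: v)) f).
    exact: dsh.
  exact: df0.
have [|t tI DE] := @MVT_line ('D_u f) (x + s *: u) v e e0.
  by move=> t tI; apply: D1f; exact: UU.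
exists (s, t); first by rewrite sI tI.
rewrite /= -mulrA -DE.
transitivity (g (x + e *: u) - g x); first by rewrite /g; ring.
rewrite gE; congr (_ * _).
rewrite /g (@deriveB _ _ _ (fun y => f (y + e *: v)) f); last 2 first.
- exact/diff_derivable/dsh.
- exact/diff_derivable/df0.
rewrite (@derive_precomp _ _ _ _ (fun y => y + e *: v) f _ u u) // => h.
by rewrite -!addrA.
Qed.

Lemma nbhs_parallelogram (N : set V) (x u v : V) : nbhs x N ->
  exists2 e : R, 0 < e & forall s t, 0 <= s <= e -> 0 <= t <= e ->
    N (x + s *: u + t *: v).
Proof.
move=> /nbhs_ballP[d /= d0 dN].
have uv0 : 0 < `|u| + `|v| + 1 by rewrite ltr_wpDl// addr_ge0.
(* The summand 1 keeps the denominator positive when [u] and [v] vanish, and makes the final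
   estimate strict. *)
exists (d / (`|u| + `|v| + 1)); first exact: divr_gt0.
move=> s t /andP[s0 se] /andP[t0 te]; apply: dN; rewrite -ball_normE /ball_ /=.
rewrite -addrA opprD addNKr normrN (le_lt_trans (ler_normD _ _))// !normrZ !ger0_norm//.
set e := d / _ in se te.
have -> : d = e * (`|u| + `|v| + 1) by rewrite /e divfK// gt_eqF.
have e0 : 0 < e by exact: divr_gt0.
rewrite !mulrDr mulr1 ltr_pwDr// lerD// ler_wpM2r//.
Qed.

(** The second difference of [f] is symmetric in [u] and [v], so [g] and [h] take a common value at
    two points of an arbitrarily small parallelogram. Continuity at [x] then bounds [g x - h x] by
    any positive [e]. *)
Lemma eq_mean_values (U : set V) (f g h : V -> R) (x u v : V) :
  open U -> U x -> {for x, continuous g} -> {for x, continuous h} ->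
  (forall e, 0 < e ->
    (forall s t, 0 <= s <= e -> 0 <= t <= e -> U (x + s *: u + t *: v)) ->
    exists2 st : R * R, (0 <= st.1 <= e) && (0 <= st.2 <= e) &
      f (x + e *: u + e *: v) - f (x + e *: u) - f (x + e *: v) + f x =
      e * e * g (x + st.1 *: u + st.2 *: v)) ->
  (forall e, 0 < e ->
    (forall s t, 0 <= s <= e -> 0 <= t <= e -> U (x + s *: v + t *: u)) ->
    exists2 st : R * R, (0 <= st.1 <= e) && (0 <= st.2 <= e) &
      f (x + e *: v + e *: u) - f (x + e *: v) - f (x + e *: u) + f x =
      e * e * h (x + st.1 *: v + st.2 *: u)) ->
  g x = h x.
Proof.
rewrite /prop_for => oU Ux cg ch Dg Dh.
apply/eqP; rewrite -subr_eq0 -normr_le0; apply/ler_addgt0Pl => /= e e0.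
rewrite addr0.
have e20 : 0 < e / 2 by rewrite divr_gt0.
have : nbhs x (U `&` ((fun y => `|g x - g y| < e / 2) `&`
    (fun y => `|h x - h y| < e / 2))).
  apply: filterI; first exact: open_nbhs_nbhs.
  by apply: filterI; [move/cvgrPdist_lt : cg|move/cvgrPdist_lt : ch]; apply.
move=> /nbhs_parallelogram - /(_ u v)[d d0 dN].
have [|[s t] /= /andP[sI0 tI0] E1] := Dg d d0.
  by move=> s t sI tI; have [] := dN s t sI tI.
have [|[t' s'] /= /andP[t'I0 s'I0] E2] := Dh d d0.
  by move=> t' s' sI tI; rewrite addrAC; have [] := dN s' t' tI sI.
have [_ [/ltW A _]] := dN s t sI0 tI0.
have [_ [_ /ltW B]] := dN s' t' s'I0 t'I0.
have E : g (x + s *: u + t *: v) = h (x + s' *: u + t' *: v).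
  have dd : d * d != 0 by rewrite mulf_neq0// gt_eqF.
  apply: (mulfI dd).
  rewrite (addrAC x (s' *: u)) -E1 -E2 (addrAC x (d *: v)).
  by congr (_ + _); exact: addrAC.
rewrite -(subrKA (g (x + s *: u + t *: v))) (le_trans (ler_normD _ _))//.
by rewrite [leRHS]splitr lerD// E distrC.
Qed.

(** The two mixed derivatives are the mean values of the second difference in the two orders of [u]
    and [v]; class C^2 makes both continuous. *)
Theorem schwarz (U : set V) (f : V -> R) (x u v : V) : open U -> U x ->
  class_C 2 U f -> 'D_v ('D_u f) x = 'D_u ('D_v f) x.
Proof.
move=> oU Ux Cf.
apply: (@eq_mean_values U f ('D_v ('D_u f)) ('D_u ('D_v f)) x u v oU Ux).
- exact: ((Cf.2 u).2 v) x Ux.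
- exact: ((Cf.2 v).2 u) x Ux.
- by move=> e e0; exact: second_difference.
- by move=> e e0; exact: second_difference.
Qed.

End Schwarz.

(** * Product rule, smooth maps, and slices of maps on a product *)

Section PartialDerivatives.
Context {R : realType}.
Implicit Types V W : normedModType R.

Lemma derive_mulfun V (f g : V -> R) x v :
  differentiable f x -> differentiable g x ->
  'D_v (fun y => f y * g y) x = 'D_v f x * g x + f x * 'D_v g x.
Proof.
move=> df dg; rewrite (@deriveM _ _ f g); try exact: diff_derivable.
by rewrite addrC; congr (_ + _); rewrite /GRing.scale/= mulrC.
Qed.

Lemma derive_cstmul V (c : R) (g : V -> R) x v : differentiable g x ->
  'D_v (fun y => c * g y) x = c * 'D_v g x.
Proof.
move=> dg; rewrite (@derive_mulfun _ (cst c))//.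
by rewrite derive_cst mul0r add0r.
Qed.

Lemma derive_sumfun V n (h : 'I_n -> V -> R) x v :
  (forall i, differentiable (h i) x) ->
  'D_v (fun y => \sum_i h i y) x = \sum_i 'D_v (h i) x.
Proof.
move=> dh; rewrite -derive_sum; last by move=> i; exact: diff_derivable.
by congr ('D_v _ x); apply/funext => y; rewrite fct_sumE.
Qed.

Lemma smooth_onP V W (U : set V) (f : V -> W) x : smooth_on U f -> U x ->
  differentiable f x.
Proof. by move=> sf Ux; apply: (sf 1%N).1. Qed.

Lemma smooth_on_continuous V W (U : set V) (f : V -> W) x : smooth_on U f ->
  U x -> {for x, continuous f}.
Proof. by move=> sf Ux; apply: (sf 0%N). Qed.

Lemma smooth_on_derive V W (U : set V) (f : V -> W) v : smooth_on U f ->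
  smooth_on U ('D_v f).
Proof. by move=> sf n; apply: (sf n.+1).2. Qed.

Lemma open_preimage_on V W (O : set V) (U : set W) (f : V -> W) :
  open O -> open U -> (forall x, O x -> {for x, continuous f}) ->
  open (O `&` f @^-1` U).
Proof.
move=> oO oU cf; rewrite openE => x [Ox Ufx]; apply: filterI.
  exact: open_nbhs_nbhs.
by apply: (cf x Ox); exact: open_nbhs_nbhs.
Qed.

Lemma derive_slicel V W V' (F : V * W -> V') x y v :
  'D_v (fun x => F (x, y)) x = 'D_(v, 0) F (x, y).
Proof.
apply: (@derive_precomp _ _ _ _ (fun x => (x, y))) => h.
by congr pair; rewrite /= scaler0 add0r.
Qed.

Lemma derive_slicer V W V' (F : V * W -> V') x y v :
  'D_v (fun y => F (x, y)) y = 'D_(0, v) F (x, y).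
Proof.
apply: (@derive_precomp _ _ _ _ (fun y => (x, y))) => h.
by congr pair; rewrite /= scaler0 add0r.
Qed.

Lemma smooth_slicel V W V' (O : set (V * W)) (U : set V) (F : V * W -> V') y :
  (forall x, U x -> O (x, y)) -> smooth_on O F ->
  smooth_on U (fun x => F (x, y)).
Proof.
move=> UO sF n; apply: (@class_C_precomp _ _ _ _ _ O _ (fun x => (x, y))) => //.
by move=> v; exists (v, 0) => h x; congr pair; rewrite /= scaler0 add0r.
Qed.

Lemma smooth_slicer V W V' (O : set (V * W)) (U : set W) (F : V * W -> V') x :
  (forall y, U y -> O (x, y)) -> smooth_on O F ->
  smooth_on U (fun y => F (x, y)).
Proof.
move=> UO sF n; apply: (@class_C_precomp _ _ _ _ _ O _ (fun y => (x, y))) => //.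
by move=> v; exists (0, v) => h y; congr pair; rewrite /= scaler0 add0r.
Qed.

Lemma derive_pair V W V' (f : V' -> V) (g : V' -> W) x v :
  differentiable f x -> differentiable g x ->
  'D_v (fun y => (f y, g y)) x = ('D_v f x, 'D_v g x).
Proof.
move=> df dg; rewrite !deriveE ?diff_pair //.
exact: differentiable_pair.
Qed.

Lemma near_slicel (V W : topologicalType) (O : set (V * W)) (x : V) (y : W) :
  nbhs (x, y) O -> \forall x' \near x, O (x', y).
Proof.
move=> Oxy; have : (fun x' : V => (x', y)) @ x --> (x, y).
  by apply: cvg_pair; [exact: cvg_id|exact: cvg_cst].
by apply.
Qed.

Lemma near_slicer (V W : topologicalType) (O : set (V * W)) (x : V) (y : W) :
  nbhs (x, y) O -> \forall y' \near y, O (x, y').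
Proof.
move=> Oxy; have : (fun y' : W => (x, y')) @ y --> (x, y).
  by apply: cvg_pair; [exact: cvg_cst|exact: cvg_id].
by apply.
Qed.

Lemma open_slicel (V W : topologicalType) (O : set (V * W)) (y : W) :
  open O -> open [set x | O (x, y)].
Proof.
move=> oO; rewrite openE => x Oxy.
by apply: near_slicel; exact: open_nbhs_nbhs.
Qed.

End PartialDerivatives.

(* Otherwise the unifier unfolds derivatives to limits when it compares them. *)
Local Opaque derive.

(** * Commutators of the infinitesimal operators of a local action *)

Section LocalAction.
Context {R : realType} {r p : nat}.
Notation E := 'rV[R]_r.
Notation Z := 'rV[R]_p.
Context (x0 : E) (m : E * E -> E) (N : set (E * E)).
Context (A : E * Z -> Z) (O : set (E * Z)) (U : set Z).
Hypotheses (oN : open N) (N0 : N (x0, x0)) (sm : smooth_on N m).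
Hypotheses (m1 : \forall x \near x0, m (x, x0) = x)
           (m2 : \forall x \near x0, m (x0, x) = x).
Hypotheses (oO : open O) (oU : open U) (UO : forall z, U z -> O (x0, z)).
Hypotheses (sA : smooth_on O A) (A1 : forall z, U z -> A (x0, z) = z).
Hypothesis (AA : forall z, U z -> \forall x \near x0, \forall y \near x0,
  A (x, A (y, z)) = A (m (x, y), z)).

Definition lie_derivative (v : E) (f : Z -> R) (z : Z) : R :=
  'D_(v, 0) (fun xz => f (A xz)) (x0, z).

(** This is [B(v, w)], taken coordinate by coordinate because [schwarz] concerns real-valued
    functions. *)
Definition second_order (v w : E) : E :=
  \row_i 'D_(v, 0) ('D_(0, w) (fun xy => m xy 0 i)) (x0, x0).

Lemma smooth_pullback (f : Z -> R) : smooth_on U f ->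
  smooth_on (O `&` A @^-1` U) (fun xz => f (A xz)).
Proof.
move=> sf n; apply: (class_C_comp _ _ _ (sf n)).
- by apply: open_preimage_on => // x; exact: smooth_on_continuous.
- by move=> x [].
- by apply: class_C_sub (sA n) => x [].
Qed.

Let oO' : open (O `&` A @^-1` U).
Proof. by apply: open_preimage_on => // x; exact: smooth_on_continuous. Qed.

Let UO' z : U z -> (O `&` A @^-1` U) (x0, z).
Proof. by move=> Uz; split; [exact: UO|rewrite /preimage/= A1]. Qed.

Lemma smooth_lie_derivative v (f : Z -> R) : smooth_on U f ->
  smooth_on U (lie_derivative v f).
Proof.
move=> sf; apply: (@smooth_slicer _ _ _ _ (O `&` A @^-1` U) U
  ('D_(v, 0) (fun xz => f (A xz))) x0) => //.
exact/smooth_on_derive/smooth_pullback.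
Qed.

Lemma lie_derivativeE v (f : Z -> R) z : U z -> differentiable f z ->
  lie_derivative v f z = 'D_('D_(v, 0) A (x0, z)) f z.
Proof.
move=> Uz df; rewrite /lie_derivative derive_comp ?A1 //.
exact: smooth_onP (UO Uz).
Qed.

Lemma lie_derivative_linear a v w (f : Z -> R) z : U z -> differentiable f z ->
  lie_derivative (a *: v + w) f z =
  a * lie_derivative v f z + lie_derivative w f z.
Proof.
move=> Uz df; rewrite /lie_derivative.
have dfA : differentiable (fun xz => f (A xz)) (x0, z).
  apply: (@differentiable_comp _ _ _ _ A f); last by rewrite A1.
  exact: smooth_onP (UO Uz).
rewrite !deriveE//.
have -> : (a *: v + w, 0) = a *: (v, 0) + (w, 0) :> E * Z.
  by congr pair; rewrite /= scaler0 addr0.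
by rewrite linearP.
Qed.

(** The action law is differentiated in [y] along [w] for each [x] near [x0], then in [x] along [v]
    at [x0]. Second derivatives of [m] produce the term with [second_order]. *)
Lemma lie_derivative_twice v w (f : Z -> R) z : smooth_on U f -> U z ->
  lie_derivative w (lie_derivative v f) z =
  'D_v ('D_w (fun x => f (A (x, z)))) x0 + lie_derivative (second_order v w) f z.
Proof.
move=> sf Uz; set F := fun xz => f (A xz); pose k x := F (x, z).
have sF : smooth_on (O `&` A @^-1` U) F by exact: smooth_pullback.
have oO1 := oO'; have UO1 := UO'; set O' := O `&` A @^-1` U in sF oO1 UO1.
pose I := [set x | O' (x, z)].
have oI : open I.
  exact: open_slicel.
have sk : smooth_on I k by apply: smooth_slicel sF.
have I0 : I x0 by exact: UO1.
have nI : \forall x \near x0, I x by apply: open_nbhs_nbhs.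
have nN : \forall x \near x0, N (x, x0).
  by apply: near_slicel; exact: open_nbhs_nbhs.
have smi i : smooth_on N (fun xy => m xy 0 i) by move=> n; exact: class_C_coord.
(* Derivative of [f (A (x, A (y, z))) = f (A (m (x, y), z))] in [y] at [x0] along [w]. On the left
   the coefficients do not depend on [x]; on the right [m (x, x0) = x] locates the derivative of
   [k]. *)
have key : \forall x \near x0,
    \sum_l 'D_(w, 0) A (x0, z) 0 l * 'D_(0, delta_mx 0 l) F (x, z) =
    \sum_i 'D_(0, w) (fun xy => m xy 0 i) (x, x0) * 'D_(delta_mx 0 i) k x.
  near=> x.
  have Ix : I x by near: x.
  have Nx : N (x, x0) by near: x.
  have mx : m (x, x0) = x by near: x.
  transitivity ('D_w (fun y => F (x, A (y, z))) x0).
    rewrite (@derive_comp_coord _ _ _ _ (fun y => A (y, z)) (fun z => F (x, z))).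
    - apply: eq_bigr => l _.
      by rewrite derive_slicel derive_slicer A1.
    - apply: (@smooth_onP _ _ _ [set x | O (x, z)]); last exact: UO.
      by apply: smooth_slicel sA.
    - rewrite A1//; apply: (@smooth_onP _ _ _ [set z | O' (x, z)]) => //.
      by apply: smooth_slicer sF.
  transitivity ('D_w (fun y => k (m (x, y))) x0).
    apply: near_eq_derive; near=> y; rewrite /k /F; congr f.
    by near: y; near: x; exact: AA.
  have dm : differentiable (fun y => m (x, y)) x0.
    apply: (@smooth_onP _ _ _ [set y | N (x, y)]) => //.
    by apply: smooth_slicer sm.
  rewrite (@derive_comp_coord _ _ _ _ (fun y => m (x, y)) k) ?mx//.
    apply: eq_bigr => i _; congr (_ * _).
    by rewrite -derive_coord// (derive_slicer (fun xy => m xy 0 i)).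
  exact: smooth_onP Ix.
(* The identity holds for all [x] near [x0], so both sides have the same derivative along [v]
   there. *)
have := near_eq_derive v key.
rewrite derive_sumfun; last first.
  move=> l; apply: differentiableM; first exact: differentiable_cst.
  apply: (@smooth_onP _ _ _ I) => //.
  by apply: smooth_slicel (smooth_on_derive _ sF).
rewrite derive_sumfun; last first.
  move=> i; apply: differentiableM.
    apply: (@smooth_onP _ _ _ [set x | N (x, x0)]) => //.
    by apply: smooth_slicel (smooth_on_derive _ (smi i)).
  exact: smooth_onP (smooth_on_derive _ sk) _.
have dTvf : differentiable (lie_derivative v f) z.
  exact: smooth_onP (smooth_lie_derivative _ sf) _.
have dA0 : differentiable A (x0, z) by exact: smooth_onP (UO Uz).
(* Schwarz lets the derivative along [(v, 0)] act first, which turns [F] into [T_v f]; the remaining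
   sum is its derivative along the vector field of [w]. *)
have -> : \sum_l 'D_v (fun y => 'D_(w, 0) A (x0, z) 0 l *
    'D_(0, delta_mx 0 l) F (y, z)) x0 = lie_derivative w (lie_derivative v f) z.
  rewrite [RHS]lie_derivativeE// [X in 'D_X _ z]row_sum_delta derive_sum_dir//.
  apply: eq_bigr => l _; rewrite derive_cstmul; last first.
    apply: (@smooth_onP _ _ _ I) => //.
    by apply: smooth_slicel (smooth_on_derive _ sF).
  apply: (congr1 ( *%R _)); rewrite (derive_slicel ('D_(0, delta_mx 0 l) F)).
  rewrite (schwarz (0, delta_mx 0 l) (v, 0) oO1 (UO1 z Uz) (sF 2%N)).
  exact: esym (derive_slicer ('D_(v, 0) F) x0 z _).
move=> ->.
(* Product rule. In the second sum the first factor is evaluated at [x0], where [m (x0, y) = y]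
   makes it the coordinate [w 0 i]. *)
rewrite [LHS](_ : _ =
  \sum_i 'D_v ('D_(0, w) (fun xy => m xy 0 i) \o (pair^~ x0)) x0 *
    'D_(delta_mx 0 i) k x0 +
  \sum_i w 0 i * 'D_v ('D_(delta_mx 0 i) k) x0); last first.
  rewrite -big_split; apply: eq_bigr => i _; rewrite derive_mulfun; last 2 first.
  - apply: (@smooth_onP _ _ _ [set x | N (x, x0)]) => //.
    by apply: smooth_slicel (smooth_on_derive _ (smi i)).
  - exact: smooth_onP (smooth_on_derive _ sk) _.
  suff -> : 'D_(0, w) (fun xy => m xy 0 i) (x0, x0) = w 0 i by [].
  rewrite -derive_slicer (@near_eq_derive _ _ _ _ (fun y : E => y 0 i)); last first.
    by near=> y; rewrite (near m2 y).
  by rewrite derive_coord ?derive_id.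
set S1 := \sum_i _; set S2 := \sum_i _.
(* The sum over directions can be collected only in the outer derivative, so Schwarz first moves the
   basis directions outside, and then exchanges [v] and [w] back. *)
have -> : S2 = 'D_v ('D_w k) x0.
  rewrite /S2; under eq_bigr => i do rewrite (schwarz (delta_mx 0 i) v oI I0 (sk 2%N)).
  rewrite -derive_sum_dir -?row_sum_delta; last first.
    exact: smooth_onP (smooth_on_derive _ sk) _.
  exact: (schwarz v w oI I0 (sk 2%N)).
suff -> : S1 = lie_derivative (second_order v w) f z by rewrite addrC.
rewrite /lie_derivative -derive_slicel [X in 'D_X k x0]row_sum_delta.
rewrite derive_sum_dir; last exact: smooth_onP sk _.
by apply: eq_bigr => i _; rewrite mxE -derive_slicel.
Unshelve. all: by end_near. Qed.

(** The pure second derivatives of [x |-> f (A (x, z))] cancel by Schwarz, and linearity of [T] in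
    the vector joins the two remaining terms. *)
Lemma lie_derivative_commutator v w (f : Z -> R) z : smooth_on U f -> U z ->
  lie_derivative w (lie_derivative v f) z -
    lie_derivative v (lie_derivative w f) z =
  lie_derivative (second_order v w - second_order w v) f z.
Proof.
move=> sf Uz; rewrite !lie_derivative_twice// opprD addrACA.
rewrite (@schwarz _ _ [set x | (O `&` A @^-1` U) (x, z)]
  (fun x => f (A (x, z))) x0 v w); last 3 first.
- exact: (open_slicel _ oO').
- exact: UO'.
- exact: (@smooth_slicel _ _ _ _ (O `&` A @^-1` U) _
    (fun xz => f (A xz)) z (fun=> id) (smooth_pullback sf)).
rewrite subrr add0r.
rewrite [in RHS]addrC -(scaleN1r (second_order w v)) lie_derivative_linear//.
  by rewrite mulN1r addrC.
exact: smooth_onP sf Uz.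
Qed.

End LocalAction.

Lemma smooth_on_id (R : realType) (V : normedModType R) (U : set V) :
  smooth_on U id.
Proof.
case=> [|n] /=; first by move=> x _; exact: cvg_id.
split=> [//|v]; rewrite (_ : 'D_v id = cst v); first exact: class_C_cst.
by apply/funext => x; rewrite derive_id.
Qed.

Lemma smooth_on_coord (R : realType) (n : nat) (U : set 'rV[R]_n) i :
  open U -> smooth_on U (fun z : 'rV[R]_n => z 0 i).
Proof. by move=> oU k; apply: class_C_coord => //; exact: smooth_on_id. Qed.

(** * The group law in a chart at the unit, and the Jacobi identity of [b] *)

Section ChartGroup.
Context {R : realType} {r : nat} {G : lieGroupType R r} (c : chart R r G).
Hypothesis hc : chart_at_unit c.
Notation E := 'rV[R]_r.

Definition chart_unit : E := chart_map c 1%g.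

Definition chart_mul (xy : E * E) : E :=
  chart_map c (chart_inv c xy.1 * chart_inv c xy.2)%g.

Definition chart_mul_dom : set (E * E) :=
  [set xy | [/\ chart_img c xy.1, chart_img c xy.2
    & chart_dom c (chart_inv c xy.1 * chart_inv c xy.2)%g]].

Lemma chart_img_unit : chart_img c chart_unit.
Proof. by apply: chart_map_img; case: hc. Qed.

Lemma chart_inv_unit : chart_inv c chart_unit = 1%g.
Proof. by rewrite /chart_unit chart_mapK //; case: hc. Qed.

Lemma chart_mul_domr x : chart_img c x -> chart_mul_dom (x, chart_unit).
Proof.
move=> cx; split=> //=; first exact: chart_img_unit.
by rewrite chart_inv_unit mulg1; exact: chart_inv_dom.
Qed.

Lemma chart_mul_doml x : chart_img c x -> chart_mul_dom (chart_unit, x).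
Proof.
move=> cx; split=> //=; first exact: chart_img_unit.
by rewrite chart_inv_unit mul1g; exact: chart_inv_dom.
Qed.

Lemma chart_mulr x : chart_img c x -> chart_mul (x, chart_unit) = x.
Proof. by move=> cx; rewrite /chart_mul /= chart_inv_unit mulg1 chart_invK. Qed.

Lemma chart_mull x : chart_img c x -> chart_mul (chart_unit, x) = x.
Proof. by move=> cx; rewrite /chart_mul /= chart_inv_unit mul1g chart_invK. Qed.

Lemma chart_inv_mul xy : chart_mul_dom xy ->
  chart_inv c (chart_mul xy) = (chart_inv c xy.1 * chart_inv c xy.2)%g.
Proof. by case=> _ _; exact: chart_mapK. Qed.

Lemma smooth_chart_mul : smooth_on chart_mul_dom chart_mul.
Proof. by have [ac _] := hc; exact: lie_mul_smooth. Qed.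

Lemma open_chart_mul_dom : open chart_mul_dom.
Proof.
rewrite openE => -[x y] [/= cx cy cxy].
have nx : \forall xy \near (x, y), chart_img c xy.1.
  by apply: cvg_fst; apply: open_nbhs_nbhs; split => //; exact: chart_img_open.
have ny : \forall xy \near (x, y), chart_img c xy.2.
  by apply: cvg_snd; apply: open_nbhs_nbhs; split => //; exact: chart_img_open.
have nxy : \forall xy \near (x, y),
    chart_dom c (chart_inv c xy.1 * chart_inv c xy.2)%g.
  have cinv : (chart_inv c xy.1, chart_inv c xy.2) @[xy --> (x, y)] -->
      (chart_inv c x, chart_inv c y).
    apply: cvg_pair.
      apply: (@cvg_comp _ _ _ fst (chart_inv c)); first exact: cvg_fst.
      exact: chart_inv_continuous.
    apply: (@cvg_comp _ _ _ snd (chart_inv c)); first exact: cvg_snd.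
    exact: chart_inv_continuous.
  have /= := cvg_comp _ _ cinv
    (@lie_mul_continuous R r G (chart_inv c x, chart_inv c y)).
  by apply; apply: open_nbhs_nbhs; split => //; exact: chart_dom_open.
by near=> xy; split; near: xy.
Unshelve. all: by end_near. Qed.

Lemma near_chart_img x : chart_img c x -> \forall x' \near x, chart_img c x'.
Proof.
by move=> cx; apply: open_nbhs_nbhs; split => //; exact: chart_img_open.
Qed.

Lemma near_chart_mul_dom xy : chart_mul_dom xy ->
  \forall xy' \near xy, chart_mul_dom xy'.
Proof.
by move=> cx; apply: open_nbhs_nbhs; split => //; exact: open_chart_mul_dom.
Qed.

(** Once the products [xy] and [yz] lie in the domain of the chart, both sides are [chart_map c] of
    the same triple product in the group. *)
Lemma near_chart_mulA z : chart_img c z ->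
  \forall x \near chart_unit, \forall y \near chart_unit,
    chart_mul (x, chart_mul (y, z)) = chart_mul (chart_mul (x, y), z).
Proof.
move=> cz; near=> x.
have cx : chart_img c x.
  by near: x; apply: near_chart_img; exact: chart_img_unit.
near=> y.
have Nxy : chart_mul_dom (x, y).
  near: y; apply: (@near_slicer _ _ chart_mul_dom).
  exact/near_chart_mul_dom/chart_mul_domr.
have Nyz : chart_mul_dom (y, z).
  near: y; apply: (@near_slicel _ _ chart_mul_dom).
  exact/near_chart_mul_dom/chart_mul_doml.
by rewrite {1 3}/chart_mul /= !chart_inv_mul //= mulgA.
Unshelve. all: by end_near. Qed.

Definition second_order_mul := second_order chart_unit chart_mul.

Definition chart_bracket (v w : E) : E :=
  second_order_mul v w - second_order_mul w v.

Lemma chart_bracket_anti v w : chart_bracket v w = - chart_bracket w v.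
Proof. by rewrite opprB. Qed.

Local Notation T := (lie_derivative chart_unit chart_mul).

(** The group acts on itself by left translation: the commutator formula applies with [A] and [m]
    both equal to [chart_mul c], and local associativity is the action law. *)
Lemma chart_commutator v w (f : E -> R) z : smooth_on (chart_img c) f ->
  chart_img c z ->
  T w (T v f) z - T v (T w f) z = T (chart_bracket v w) f z.
Proof.
apply: (@lie_derivative_commutator _ _ _ _ _ chart_mul_dom _ chart_mul_dom).
- exact: open_chart_mul_dom.
- exact/chart_mul_domr/chart_img_unit.
- exact: smooth_chart_mul.
- near=> x; apply: chart_mulr; near: x.
  exact/near_chart_img/chart_img_unit.
- near=> x; apply: chart_mull; near: x.
  exact/near_chart_img/chart_img_unit.
- exact: open_chart_mul_dom.
- exact: chart_img_open.
- exact: chart_mul_doml.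
- exact: smooth_chart_mul.
- exact: chart_mull.
- exact: near_chart_mulA.
Unshelve. all: by end_near. Qed.

Lemma smooth_chart_lie_derivative v (f : E -> R) :
  smooth_on (chart_img c) f -> smooth_on (chart_img c) (T v f).
Proof.
apply: (@smooth_lie_derivative _ _ _ _ _ chart_mul_dom).
- exact: open_chart_mul_dom.
- exact: chart_img_open.
- exact: chart_mul_doml.
- exact: smooth_chart_mul.
- exact: chart_mull.
Qed.

Lemma chart_lie_derivativeE v (f : E -> R) z :
  chart_img c z -> differentiable f z ->
  T v f z = 'D_('D_(v, 0) chart_mul (chart_unit, z)) f z.
Proof.
apply: (@lie_derivativeE _ _ _ _ _ chart_mul_dom).
- exact: chart_mul_doml.
- exact: smooth_chart_mul.
- exact: chart_mull.
Qed.

(** The commutator formula holds on the whole open image of the chart, so it may be differentiated;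
    at [z], [T u] is a directional derivative. *)
Lemma chart_lie_derivative_bracket u v w (f : E -> R) z :
  smooth_on (chart_img c) f -> chart_img c z ->
  T u (T (chart_bracket v w) f) z = T u (T w (T v f)) z - T u (T v (T w f)) z.
Proof.
move=> sf cz; have sT a b : smooth_on (chart_img c) (T a (T b f)).
  by do 2 apply: smooth_chart_lie_derivative.
have dT a b : differentiable (T a (T b f)) z by exact: smooth_onP (sT a b) cz.
have db : differentiable (T (chart_bracket v w) f) z.
  exact: smooth_onP (smooth_chart_lie_derivative _ sf) cz.
apply: etrans (chart_lie_derivativeE u cz db) _; apply: esym.
apply: etrans (congr2 (fun a b => a - b) (chart_lie_derivativeE u cz (dT w v))
  (chart_lie_derivativeE u cz (dT v w))) _.
set X := 'D_(u, 0) chart_mul (chart_unit, z); rewrite /=.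
have dB : 'D_X (T w (T v f) - T v (T w f)) z =
    'D_X (T w (T v f)) z - 'D_X (T v (T w f)) z.
  by apply: deriveB; [exact: diff_derivable (dT w v)|exact: diff_derivable (dT v w)].
apply: etrans (esym dB) _; apply: esym.
apply: (open_eq_derive _ _ _ cz); first exact: chart_img_open.
move=> y; rewrite inE => cy; exact/esym/chart_commutator.
Qed.

(** At the unit [T v] is the derivative along [v], because [chart_mul c (x, e) = x]. A vector is
    thus recovered from its operator, which transfers operator identities to [b]. *)
Lemma chart_lie_derivative_coord v i :
  T v (fun z : E => z 0 i) chart_unit = v 0 i.
Proof.
rewrite /lie_derivative -derive_slicel.
rewrite (@open_eq_derive _ _ _ (chart_img c) _ (fun z : E => z 0 i)).
- by rewrite derive_coord ?derive_id.
- exact: chart_img_open.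
- by move=> x; rewrite inE => cx; rewrite chart_mulr.
- exact: chart_img_unit.
Qed.

Lemma chart_bracket_jacobi u v w :
  chart_bracket u (chart_bracket v w) + chart_bracket v (chart_bracket w u) +
  chart_bracket w (chart_bracket u v) = 0.
Proof.
apply/rowP => i; pose f (z : E) := z 0 i.
have sf : smooth_on (chart_img c) f.
  by apply: smooth_on_coord; exact: chart_img_open.
(* Here [t a b d] is [T_a T_b T_d] applied to the coordinate [f] at the unit. A nested bracket is a
   commutator of commutators, hence four such terms, and the twelve terms of the cyclic sum
   cancel. *)
have [t tE] : exists t : E -> E -> E -> R, forall a b d,
    chart_bracket a (chart_bracket b d) 0 i = t d b a - t b d a - (t a d b - t a b d).
  exists (fun a b d => T a (T b (T d f)) chart_unit) => a b d.
  apply: etrans (esym (chart_lie_derivative_coord _ _)) _.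
  apply: etrans (esym (chart_commutator _ _ sf chart_img_unit)) _.
  apply: congr2; last first.
    exact: congr1 (chart_lie_derivative_bracket _ _ _ sf chart_img_unit).
  apply: esym (chart_commutator _ _ _ chart_img_unit).
  exact: smooth_chart_lie_derivative.
by move: chart_bracket tE => br brE; rewrite !mxE !brE; ring.
Qed.

Lemma smooth_chart_mul_coord i :
  smooth_on chart_mul_dom (fun xy => chart_mul xy 0 i).
Proof.
move=> n; apply: class_C_coord; first exact: open_chart_mul_dom.
exact: smooth_chart_mul.
Qed.

Lemma chart_mul_dom_unit : chart_mul_dom (chart_unit, chart_unit).
Proof. exact/chart_mul_domr/chart_img_unit. Qed.

(** Schwarz brings the second argument to the outer derivative, where linearity in it is linearity
    of a differential. *)
Lemma second_order_mulC v w i :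
  second_order_mul v w 0 i =
  'D_(0, w) ('D_(v, 0) (fun xy => chart_mul xy 0 i)) (chart_unit, chart_unit).
Proof.
rewrite mxE; apply: (schwarz _ _ open_chart_mul_dom chart_mul_dom_unit).
exact: (@smooth_chart_mul_coord i 2%N).
Qed.

Lemma second_order_mul_linearl w : linear (second_order_mul^~ w).
Proof.
move=> a x y; apply/rowP => i; rewrite [RHS]mxE [X in _ = X + _]mxE.
rewrite [LHS]mxE [in X in _ = _ * X + _]mxE [X in _ = _ + X]mxE.
have df : differentiable ('D_(0, w) (fun xy => chart_mul xy 0 i))
    (chart_unit, chart_unit).
  apply: (smooth_onP _ chart_mul_dom_unit); apply: smooth_on_derive.
  exact: smooth_chart_mul_coord.
rewrite !(deriveE _ df).
have -> : (a *: x + y, 0) = a *: (x, 0) + (y, 0) :> E * E.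
  by congr pair; rewrite /= scaler0 addr0.
by rewrite linearP.
Qed.

Lemma second_order_mul_linearr v : linear (second_order_mul v).
Proof.
move=> a x y; apply/rowP => i; rewrite [RHS]mxE [X in _ = X + _]mxE.
apply: etrans (second_order_mulC _ _ _) _; apply: esym.
apply: etrans (congr2 (fun s t => a * s + t) (second_order_mulC v x i)
  (second_order_mulC v y i)) _; apply: esym; rewrite /=.
have df : differentiable ('D_(v, 0) (fun xy => chart_mul xy 0 i))
    (chart_unit, chart_unit).
  apply: (smooth_onP _ chart_mul_dom_unit); apply: smooth_on_derive.
  exact: smooth_chart_mul_coord.
rewrite !(deriveE _ df).
have -> : (0, a *: x + y) = a *: (0, x) + (0, y) :> E * E.
  by congr pair; rewrite /= scaler0 addr0.
by rewrite linearP.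
Qed.

Lemma chart_bracket_linearr v : linear (chart_bracket v).
Proof.
move=> a x y; rewrite /chart_bracket.
have distr (s t s' t' : E) :
    a *: s + t - (a *: s' + t') = a *: (s - s') + (t - t').
  by rewrite opprD scalerBr addrACA.
rewrite -distr.
exact: congr2 (second_order_mul_linearr v a x y)
  (congr1 -%R (second_order_mul_linearl v a x y)).
Qed.

End ChartGroup.

(** * The Lie bracket defined through [Ad] equals [b] *)

Section Exponential.
Context {R : realType} {r : nat} {G : lieGroupType R r} (c : chart R r G).
Hypothesis hc : chart_at_unit c.
Context (exp : 'rV[R]_r -> G).
Hypothesis hexp : is_exponential c exp.
Notation E := 'rV[R]_r.
Implicit Types (v w : E) (t : R).

Lemma exponential0 v : exp (0 *: v) = 1%g.
Proof.
have [addE _ _ _] := hexp v.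
by apply: (@mulgI _ (exp (0 *: v))); rewrite mulg1 -addE addr0.
Qed.

Lemma exponentialN v t : exp (- t *: v) = (exp (t *: v))^-1%g.
Proof.
have [addE _ _ _] := hexp v.
by apply: (@mulgI _ (exp (t *: v))); rewrite mulgV -addE subrr exponential0.
Qed.

Definition chart_exp v t : E := chart_map c (exp (t *: v)).

Lemma chart_exp0 v : chart_exp v 0 = chart_unit c.
Proof. by rewrite /chart_exp exponential0. Qed.

Lemma near_exp_chart_dom v : \forall t \near (0 : R), chart_dom c (exp (t *: v)).
Proof.
have [_ cexp _ _] := hexp v; apply: (cexp 0); rewrite /= exponential0.
by apply: open_nbhs_nbhs; split; [exact: chart_dom_open|case: hc].
Qed.

Lemma is_derive_chart_exp v : is_derive (0 : R) 1 (chart_exp v) v.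
Proof. by have [] := hexp v. Qed.

Lemma differentiable_chart_exp v : differentiable (chart_exp v) 0.
Proof. by apply/derivable1_diffP; have [] := is_derive_chart_exp v. Qed.

Lemma differentiable_chart_expN v : differentiable (fun t => chart_exp v (- t)) 0.
Proof.
apply: (@differentiable_comp _ _ _ _ -%R (chart_exp v)).
  exact: (@differentiableN _ _ _ id).
by rewrite oppr0; exact: differentiable_chart_exp.
Qed.

Lemma derive_chart_expN v : 'D_1 (fun t => chart_exp v (- t)) 0 = - v.
Proof.
rewrite (@derive_precomp _ _ _ _ -%R (chart_exp v) 0 1 (-1)); last first.
  by move=> h; rewrite /= opprD scalerN.
rewrite oppr0 deriveE; last exact: differentiable_chart_exp.
rewrite linearN -deriveE; last exact: differentiable_chart_exp.
by have [_ ->] := is_derive_chart_exp v.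
Qed.

Lemma derive_chart_exp_comp v (W : normedModType R) (F : E -> W) :
  differentiable F (chart_unit c) ->
  'D_1 (fun t => F (chart_exp v t)) 0 = 'D_v F (chart_unit c).
Proof.
move=> dF; rewrite (@derive_comp _ _ _ _ (chart_exp v) F) ?chart_exp0 //.
  by have [_ ->] := is_derive_chart_exp v.
exact: differentiable_chart_exp.
Qed.

Let mu i (xy : E * E) : R := chart_mul c xy 0 i.
Let e0 := chart_unit c.

(* The coordinates of Ad g w for g = exp (t v), by the chain rule applied to
   x |-> mu (mu (g, x), g^-1). *)
Definition ad_coord v w i t : R :=
  \sum_j 'D_(0, w) (mu j) (chart_exp v t, e0) *
    'D_(delta_mx 0 j, 0) (mu i) (chart_exp v t, chart_exp v (- t)).

(** For small [t], and [x] near the unit, every partial product of [g x g^-1] stays in the chart, so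
    conjugation is two multiplications in the chart, to which the chain rule applies. *)
Lemma near_Ad v w : \forall t \near (0 : R),
  Ad c (exp (t *: v)) w = \row_i ad_coord v w i t.
Proof.
(* The pair formed by [g] and its inverse tends to the pair of units, hence eventually enters the
   open set [chart_mul_dom c]. *)
have cg : (chart_exp v t, chart_exp v (- t)) @[t --> (0 : R)] --> (e0, e0).
  apply: (@cvg_pair _ _ _ (nbhs (0 : R)) (nbhs e0) (nbhs e0)).
    have := differentiable_continuous (differentiable_chart_exp v).
    by rewrite /prop_for /continuous_at chart_exp0.
  have := differentiable_continuous (differentiable_chart_expN v).
  by rewrite /prop_for /continuous_at oppr0 chart_exp0.
have nN : \forall t \near (0 : R),
    chart_mul_dom c (chart_exp v t, chart_exp v (- t)).
  by have /cg := near_chart_mul_dom (chart_mul_dom_unit hc).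
near=> t.
have dt : chart_dom c (exp (t *: v)) by near: t; exact: near_exp_chart_dom.
have Nt : chart_mul_dom c (chart_exp v t, chart_exp v (- t)).
  by near: t.
have [/= it iNt _] := Nt.
have Nt0 : chart_mul_dom c (chart_exp v t, e0) by exact: chart_mul_domr.
have inv_t : chart_inv c (chart_exp v t) = exp (t *: v) by rewrite chart_mapK.
have dNt : chart_dom c (exp (- t *: v)).
  near: t; apply/(nearN 0 (fun s => chart_dom c (exp (s *: v)))).
  by rewrite oppr0; exact: near_exp_chart_dom.
have inv_Nt : chart_inv c (chart_exp v (- t)) = (exp (t *: v))^-1%g.
  by rewrite chart_mapK // exponentialN.
transitivity ('D_w (fun x => chart_mul c (chart_mul c (chart_exp v t, x),
    chart_exp v (- t))) e0).
  rewrite /Ad; apply: near_eq_derive; near=> x.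
  have Nx : chart_mul_dom c (chart_exp v t, x).
    near: x; apply: (@near_slicer _ _ (chart_mul_dom c)).
    exact: near_chart_mul_dom.
  by rewrite {1}/chart_mul /= chart_inv_mul //= inv_t inv_Nt.
have dmt : differentiable (fun x => chart_mul c (chart_exp v t, x)) e0.
  apply: (@smooth_onP _ _ _ [set x | chart_mul_dom c (chart_exp v t, x)]) => //.
  by apply: smooth_slicer (smooth_chart_mul hc).
have dmN : differentiable (fun y => chart_mul c (y, chart_exp v (- t)))
    (chart_exp v t).
  apply: (@smooth_onP _ _ _ [set y | chart_mul_dom c (y, chart_exp v (- t))]) => //.
  by apply: smooth_slicel (smooth_chart_mul hc).
have mt : chart_mul c (chart_exp v t, e0) = chart_exp v t by exact: chart_mulr.
apply: etrans (@derive_comp_coord _ _ _ _ (fun x => chart_mul c (chart_exp v t, x))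
  (fun y => chart_mul c (y, chart_exp v (- t))) e0 w dmt _) _; rewrite mt //.
apply/rowP => i; rewrite summxE mxE; apply: eq_bigr => j _; rewrite mxE.
rewrite -derive_coord// -derive_coord//.
by rewrite (derive_slicer (mu j)) (derive_slicel (mu i)).
Unshelve. all: by end_near. Qed.

Let N0 : chart_mul_dom c (e0, e0).
Proof. exact: chart_mul_dom_unit. Qed.

Let sD i a : smooth_on (chart_mul_dom c) ('D_a (mu i)).
Proof. exact/smooth_on_derive/smooth_chart_mul_coord. Qed.

Let dP i a : differentiable ('D_a (mu i)) (e0, e0).
Proof. exact: smooth_onP (sD i a) N0. Qed.

Let dg1 v : differentiable (fun t => (chart_exp v t, e0)) (0 : R).
Proof.
apply: (@differentiable_pair _ _ _ _ (chart_exp v) (cst e0)) => //.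
exact: differentiable_chart_exp.
Qed.

Let dg2 v : differentiable (fun t => (chart_exp v t, chart_exp v (- t))) (0 : R).
Proof.
apply: differentiable_pair; first exact: differentiable_chart_exp.
exact: differentiable_chart_expN.
Qed.

Lemma is_diff_ad_left v w j :
  differentiable (fun t => 'D_(0, w) (mu j) (chart_exp v t, e0)) (0 : R) /\
  'D_1 (fun t => 'D_(0, w) (mu j) (chart_exp v t, e0)) (0 : R) =
    second_order_mul c v w 0 j.
Proof.
have d1 : differentiable ('D_(0, w) (mu j)) (chart_exp v 0, e0).
  by rewrite chart_exp0; exact: dP.
split.
  exact: (@differentiable_comp _ _ _ _ (fun t => (chart_exp v t, e0))
    ('D_(0, w) (mu j)) 0 (dg1 v) d1).
apply: etrans (@derive_comp _ _ _ _ (fun t => (chart_exp v t, e0))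
  ('D_(0, w) (mu j)) 0 1 (dg1 v) d1) _.
rewrite (@derive_pair _ _ _ _ _ (cst e0)) //; last first.
  exact: differentiable_chart_exp.
have [_ ->] := is_derive_chart_exp v.
by rewrite derive_cst chart_exp0 mxE.
Qed.

Lemma is_diff_ad_right v i j :
  differentiable
    (fun t => 'D_(delta_mx 0 j, 0) (mu i) (chart_exp v t, chart_exp v (- t)))
    (0 : R) /\
  'D_1 (fun t => 'D_(delta_mx 0 j, 0) (mu i)
          (chart_exp v t, chart_exp v (- t))) (0 : R) =
    'D_(v, - v) ('D_(delta_mx 0 j, 0) (mu i)) (e0, e0).
Proof.
have d1 : differentiable ('D_(delta_mx 0 j, 0) (mu i))
    (chart_exp v 0, chart_exp v (- 0)).
  by rewrite oppr0 chart_exp0; exact: dP.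
split.
  exact: (@differentiable_comp _ _ _ _
    (fun t => (chart_exp v t, chart_exp v (- t)))
    ('D_(delta_mx 0 j, 0) (mu i)) 0 (dg2 v) d1).
apply: etrans (@derive_comp _ _ _ _ (fun t => (chart_exp v t, chart_exp v (- t)))
  ('D_(delta_mx 0 j, 0) (mu i)) 0 1 (dg2 v) d1) _.
rewrite (@derive_pair _ _ _ _ (chart_exp v)); last 2 first.
- exact: differentiable_chart_exp.
- exact: differentiable_chart_expN.
have [_ ->] := is_derive_chart_exp v.
by rewrite derive_chart_expN oppr0 chart_exp0.
Qed.

Lemma differentiable_ad_coord v w i : differentiable (ad_coord v w i) (0 : R).
Proof.
rewrite (_ : ad_coord v w i = \sum_j ((fun t => 'D_(0, w) (mu j) (chart_exp v t, e0)) *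
    (fun t => 'D_(delta_mx 0 j, 0) (mu i) (chart_exp v t, chart_exp v (- t))))).
  apply: differentiable_sum => j; apply: differentiableM.
    exact: (is_diff_ad_left v w j).1.
  exact: (is_diff_ad_right v i j).1.
by apply/funext => t; rewrite fct_sumE.
Qed.

Lemma derive_chart_mull w i x : chart_img c x ->
  'D_(w, 0) (mu i) (x, e0) = w 0 i.
Proof.
move=> cx; rewrite -(derive_slicel (mu i)).
rewrite (@open_eq_derive _ _ _ (chart_img c) _ (fun z : E => z 0 i)) //.
- by rewrite derive_coord ?derive_id.
- exact: chart_img_open.
- by move=> y; rewrite inE /mu => cy; rewrite chart_mulr.
Qed.

Lemma derive_chart_mulr w i x : chart_img c x ->
  'D_(0, w) (mu i) (e0, x) = w 0 i.
Proof.
move=> cx; rewrite -(derive_slicer (mu i)).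
rewrite (@open_eq_derive _ _ _ (chart_img c) _ (fun z : E => z 0 i)) //.
- by rewrite derive_coord ?derive_id.
- exact: chart_img_open.
- by move=> y; rewrite inE /mu => cy; rewrite chart_mull.
Qed.

(** On the chart [mu (x, e0) = x], so the first derivative in the first variable is constant along
    this slice. *)
Lemma derive2_chart_mull v w i :
  'D_(v, 0) ('D_(w, 0) (mu i)) (e0, e0) = 0.
Proof.
rewrite -(derive_slicel ('D_(w, 0) (mu i))).
rewrite (@open_eq_derive _ _ _ (chart_img c) _ (cst (w 0 i))).
- by rewrite derive_cst.
- exact: chart_img_open.
- by move=> y; rewrite inE => cy; rewrite derive_chart_mull.
- exact: chart_img_unit.
Qed.

(** Product rule at [t = 0], where the undifferentiated factors are [w 0 j] and the Kronecker delta
    of [i] and [j]. The first sum gives [B(v, w)], the second gives [- B(w, v)]. *)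
Lemma derive_ad_coord v w i :
  'D_1 (ad_coord v w i) (0 : R) = chart_bracket c v w 0 i.
Proof.
rewrite /ad_coord derive_sumfun; last first.
  move=> j; apply: differentiableM; first exact: (is_diff_ad_left v w j).1.
  exact: (is_diff_ad_right v i j).1.
have img0 : chart_img c e0 by exact: chart_img_unit.
have smooth2 j : class_C 2 (chart_mul_dom c) (mu j).
  exact: (@smooth_chart_mul_coord _ _ _ _ hc j 2%N).
have oN := @open_chart_mul_dom _ _ _ c.
rewrite (eq_bigr (fun j => second_order_mul c v w 0 j * (delta_mx 0 j : E) 0 i +
   w 0 j * 'D_(delta_mx 0 j, 0) ('D_(v, - v) (mu i)) (e0, e0))); last first.
  move=> j _; apply: etrans (derive_mulfun _ (is_diff_ad_left v w j).1
    (is_diff_ad_right v i j).1) _.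
  rewrite (is_diff_ad_left v w j).2 (is_diff_ad_right v i j).2 oppr0 chart_exp0.
  have E := schwarz (delta_mx 0 j, 0) (v, - v) oN N0 (smooth2 i).
  exact: (congr2 +%R (congr1 ( *%R _) (derive_chart_mull _ i img0))
    (congr2 *%R (derive_chart_mulr w j img0) E)).
rewrite big_split /=.
rewrite [X in X + _](_ : _ = second_order_mul c v w 0 i); last first.
  rewrite [in RHS](row_sum_delta (second_order_mul c v w)) summxE.
  by apply: eq_bigr => j _; rewrite [RHS]mxE.
(* The sum collects into the direction [(w, 0)], which Schwarz moves inside. Of the outer direction
   [(v, - v)], the part [(v, 0)] contributes 0 and the part [(0, - v)] contributes [- B(w, v)]. *)
rewrite [X in _ + X](_ : _ = - second_order_mul c w v 0 i); last first.
  have -> : \sum_j w 0 j * 'D_(delta_mx 0 j, 0) ('D_(v, - v) (mu i)) (e0, e0) =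
      'D_(w, 0) ('D_(v, - v) (mu i)) (e0, e0).
    have -> : (w, 0) = \sum_j w 0 j *: (delta_mx 0 j, 0) :> E * E.
      rewrite [in LHS](row_sum_delta w).
      rewrite (@big_morph _ _ (fun x : E => (x, 0) : E * E) 0 +%R) //.
        by apply: eq_bigr => j _; congr pair; rewrite /= scaler0.
      by move=> x y; congr pair; rewrite /= addr0.
    by rewrite derive_sum_dir.
  rewrite (schwarz _ _ oN N0 (smooth2 i)).
  have -> : (v, - v) = (v, 0) - (0, v) :> E * E.
    by congr pair; rewrite /= ?subr0 ?sub0r.
  rewrite (deriveE _ (dP i (w, 0))) linearB -!(deriveE _ (dP i (w, 0))).
  by rewrite derive2_chart_mull sub0r -(second_order_mulC hc).
by rewrite /chart_bracket [RHS]mxE [X in _ = _ + X]mxE.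
Qed.

Lemma lie_bracketE v w : lie_bracket c exp v w = chart_bracket c v w.
Proof.
rewrite /lie_bracket derive1E (near_eq_derive _ (near_Ad v w)).
rewrite derive_mx; last first.
  apply/derivable_mxP => i j; rewrite (_ : (fun t => _) = ad_coord v w j).
    exact/diff_derivable/differentiable_ad_coord.
  by apply/funext => t; rewrite mxE.
apply/rowP => i; rewrite mxE -derive_ad_coord; congr ('D_1 _ (0 : R)).
by apply/funext => t; rewrite mxE.
Qed.

End Exponential.

(** * Pointwise algebra of the Jacobi identity *)

Section JacobiAlgebra.
Context {R : comNzRingType} {n : nat}.
Implicit Types (f h k : 'I_n -> R) (F H K : 'I_n -> 'I_n -> R).
Context (S : 'I_n -> 'I_n -> R) (DS : 'I_n -> 'I_n -> 'I_n -> R).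
Hypothesis S_anti : forall a b, S a b = - S b a.
Hypothesis S_jacobi : forall a b c,
  \sum_d (S a d * DS b c d + S b d * DS c a d + S c d * DS a b d) = 0.

(** At a fixed point, [f], [h], [k] stand for gradients, [F], [H], [K] for Hessians, and [DS b c d]
    for the derivative of [S b c] in direction [d]. This is the part of the double bracket in which
    [S] is differentiated. *)
Definition first_order f h k :=
  \sum_a \sum_d \sum_b \sum_c S a d * (f a * (DS b c d * (h b * k c))).

Definition hess_term f h K :=
  \sum_a \sum_d \sum_b \sum_c S a d * (f a * (S b c * (h b * K c d))).

Lemma exchange_big4 (X : 'I_n -> 'I_n -> 'I_n -> 'I_n -> R) :
  \sum_a \sum_d \sum_b \sum_c X a d b c = \sum_b \sum_c \sum_a \sum_d X a d b c.
Proof.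
rewrite (eq_bigr (fun a => \sum_b \sum_c \sum_d X a d b c)); last first.
  by move=> a _; rewrite exchange_big; apply: eq_bigr => b _; exact: exchange_big.
by rewrite exchange_big; apply: eq_bigr => b _; exact: exchange_big.
Qed.

(** Renaming the index pair [(a, d)] as [(b, c)] and conversely exchanges [f] with [h] and
    transposes [K]. *)
Lemma hess_term_sym f h K : (forall c d, K c d = K d c) ->
  hess_term f h K = hess_term h f K.
Proof.
move=> Ksym; rewrite /hess_term exchange_big4.
do 4 (apply: eq_bigr => ? _); rewrite Ksym; ring.
Qed.

Lemma first_orderE f h k : first_order f h k =
  \sum_a \sum_b \sum_c f a * (h b * (k c * \sum_d S a d * DS b c d)).
Proof.
apply: eq_bigr => a _; rewrite exchange_big; apply: eq_bigr => b _.
rewrite exchange_big; apply: eq_bigr => c _.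
by rewrite !mulr_sumr; apply: eq_bigr => d _; ring.
Qed.

Lemma exchange_big3 (X : 'I_n -> 'I_n -> 'I_n -> R) :
  \sum_a \sum_b \sum_c X a b c = \sum_c \sum_a \sum_b X a b c.
Proof.
rewrite [RHS]exchange_big; apply: eq_bigr => a _; exact: exchange_big.
Qed.

(** After the sums are rotated so that [f], [h], [k] carry the indices [a], [b], [c] in all three
    terms, the coefficient of [f a * h b * k c] is the sum in [S_jacobi]. *)
Lemma first_order_jacobi f h k :
  first_order f h k + first_order h k f + first_order k f h = 0.
Proof.
rewrite !first_orderE [X in _ + X + _]exchange_big3.
rewrite [X in _ + X]exchange_big3 [X in _ + X]exchange_big3.
rewrite -!big_split big1 //= => a _; rewrite -!big_split big1 //= => b _.
rewrite -!big_split big1 //= => c _.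
have := S_jacobi a b c; rewrite !big_split /=.
move: (\sum_d S a d * _) (\sum_d S b d * _) (\sum_d S c d * _) => x y z xyz.
transitivity (f a * h b * k c * (x + y + z)); first by ring.
by rewrite xyz mulr0.
Qed.

(** Each double bracket is a first-order part plus two Hessian terms, one of them negative by
    antisymmetry of [S]. In the cyclic sum every Hessian occurs twice with opposite signs, and
    [hess_term_sym] matches the two occurrences. *)
Lemma jacobi_second_order f h k F H K :
  (forall a b, F a b = F b a) -> (forall a b, H a b = H b a) ->
  (forall a b, K a b = K b a) ->
  let brbr f h k H K := \sum_a \sum_d S a d * (f a * \sum_b \sum_c
    (DS b c d * (h b * k c) + S b c * (H b d * k c + h b * K c d))) in
  brbr f h k H K + brbr h k f K F + brbr k f h F H = 0.
Proof.
move=> Fs Hs Ks brbr.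
have brbrE f' h' k' H' K' : brbr f' h' k' H' K' =
    first_order f' h' k' - hess_term f' k' H' + hess_term f' h' K'.
  rewrite -!sumrN -!big_split; apply: eq_bigr => a _ /=.
  rewrite -!sumrN -!big_split; apply: eq_bigr => d _ /=.
  rewrite [X in _ - X]exchange_big /= -!sumrN -!big_split !mulr_sumr.
  apply: eq_bigr => b _ /=.
  rewrite -!sumrN -!big_split !mulr_sumr; apply: eq_bigr => c _ /=.
  by rewrite (S_anti c b); ring.
rewrite !brbrE (hess_term_sym h f Ks) (hess_term_sym k f Hs).
rewrite (hess_term_sym k h Fs) -(first_order_jacobi f h k).
by move: (hess_term _ _ _) (hess_term _ _ _) (hess_term _ _ _) => x y z; ring.
Qed.

End JacobiAlgebra.

(** * Brackets given by a matrix of smooth functions *)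

Section StructureMatrix.
Context {R : realType} {V : normedModType R} {n : nat}.
Context (U : set V) (e : 'I_n -> V) (S : 'I_n -> 'I_n -> V -> R).
Hypotheses (oU : open U) (sS : forall a b, smooth_on U (S a b)).
Implicit Types (f h k : V -> R).

Definition structure_bracket f h (x : V) : R :=
  \sum_a \sum_b S a b x * ('D_(e a) f x * 'D_(e b) h x).

Lemma smooth_structure_bracket f h : smooth_on U f -> smooth_on U h ->
  smooth_on U (structure_bracket f h).
Proof.
move=> sf sh m; apply: class_C_sum => // a _; apply: class_C_sum => // b _.
apply: class_C_mul => //; first exact: sS.
by apply: class_C_mul => //; exact: smooth_on_derive.
Qed.

Lemma structure_bracket_linearl (t : R) f k h x :
  differentiable f x -> differentiable k x ->
  structure_bracket (fun y => t * f y + k y) h x =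
  t * structure_bracket f h x + structure_bracket k h x.
Proof.
move=> df dk; rewrite /structure_bracket mulr_sumr -big_split /=.
apply: eq_bigr => a _; rewrite mulr_sumr -big_split /=; apply: eq_bigr => b _.
have -> : 'D_(e a) (fun y => t * f y + k y) x = t * 'D_(e a) f x + 'D_(e a) k x.
  rewrite -(derive_cstmul _ _ df).
  apply: (@deriveD _ _ _ (fun y => t * f y) k); apply: diff_derivable => //.
  by apply: differentiableM => //; exact: differentiable_cst.
by move: ('D_(e a) f x) ('D_(e a) k x) ('D_(e b) h x) => ? ? ?; ring.
Qed.

Lemma structure_bracket_anti f h x : (forall a b, S a b x = - S b a x) ->
  structure_bracket f h x = - structure_bracket h f x.
Proof.
move=> Santi; rewrite /structure_bracket exchange_big -sumrN.
apply: eq_bigr => a _; rewrite -sumrN; apply: eq_bigr => b _.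
by rewrite Santi mulNr [X in - (_ * X)]mulrC.
Qed.

Lemma structure_bracket_leibniz f h k x :
  differentiable h x -> differentiable k x ->
  structure_bracket f (fun y => h y * k y) x =
  structure_bracket f h x * k x + h x * structure_bracket f k x.
Proof.
move=> dh dk; rewrite /structure_bracket mulr_suml mulr_sumr -big_split /=.
apply: eq_bigr => a _; rewrite mulr_suml mulr_sumr -big_split /=.
apply: eq_bigr => b _; rewrite (derive_mulfun _ dh dk).
by move: ('D_(e a) f x) ('D_(e b) h x) ('D_(e b) k x) => ? ? ?; ring.
Qed.

Lemma structure_bracket_ext f f' h h' x : U x ->
  {in U, f =1 f'} -> {in U, h =1 h'} ->
  structure_bracket f h x = structure_bracket f' h' x.
Proof.
move=> Ux ff' hh'; apply: eq_bigr => a _; apply: eq_bigr => b _.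
by rewrite (open_eq_derive _ oU ff' Ux) (open_eq_derive _ oU hh' Ux).
Qed.

Lemma derive_structure_bracket h k x d : smooth_on U h -> smooth_on U k -> U x ->
  'D_(e d) (structure_bracket h k) x =
  \sum_b \sum_c ('D_(e d) (S b c) x * ('D_(e b) h x * 'D_(e c) k x) +
    S b c x * ('D_(e d) ('D_(e b) h) x * 'D_(e c) k x +
               'D_(e b) h x * 'D_(e d) ('D_(e c) k) x)).
Proof.
move=> sh sk Ux.
have dh b : differentiable ('D_(e b) h) x.
  exact: smooth_onP (smooth_on_derive _ sh) Ux.
have dk b : differentiable ('D_(e b) k) x.
  exact: smooth_onP (smooth_on_derive _ sk) Ux.
have dS b c : differentiable (S b c) x by exact: smooth_onP (sS b c) Ux.
have dhk b c : differentiable (fun y => 'D_(e b) h y * 'D_(e c) k y) x.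
  exact: differentiableM.
have dt b c : differentiable
    (fun y => S b c y * ('D_(e b) h y * 'D_(e c) k y)) x.
  exact: differentiableM (dS b c) (dhk b c).
rewrite derive_sumfun; last first.
  move=> b; rewrite (_ : (fun y => _) = \sum_c (fun y => S b c y *
    ('D_(e b) h y * 'D_(e c) k y))); first exact: differentiable_sum.
  by apply/funext => y; rewrite fct_sumE.
apply: eq_bigr => b _; rewrite derive_sumfun //.
apply: eq_bigr => c _; apply: etrans (derive_mulfun _ (dS b c) (dhk b c)) _.
by apply: (congr1 (fun t => _ + _ * t)); exact: derive_mulfun (dh b) (dk c).
Qed.

(** At the point [x] this is [jacobi_second_order], with Schwarz supplying the symmetry of the
    Hessians. *)
Lemma structure_bracket_jacobi f h k x :
  smooth_on U f -> smooth_on U h -> smooth_on U k -> U x ->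
  (forall a b, S a b x = - S b a x) ->
  (forall a b c, \sum_d (S a d x * 'D_(e d) (S b c) x +
     S b d x * 'D_(e d) (S c a) x + S c d x * 'D_(e d) (S a b) x) = 0) ->
  structure_bracket f (structure_bracket h k) x +
  structure_bracket h (structure_bracket k f) x +
  structure_bracket k (structure_bracket f h) x = 0.
Proof.
move=> sf sh sk Ux Santi SJ.
have sym (g : V -> R) a b : smooth_on U g ->
    'D_(e b) ('D_(e a) g) x = 'D_(e a) ('D_(e b) g) x.
  by move=> sg; exact: (schwarz _ _ oU Ux (sg 2%N)).
have E f' h' k' : smooth_on U h' -> smooth_on U k' ->
    structure_bracket f' (structure_bracket h' k') x =
    \sum_a \sum_d S a d x * ('D_(e a) f' x * \sum_b \sum_c
      ('D_(e d) (S b c) x * ('D_(e b) h' x * 'D_(e c) k' x) +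
       S b c x * ('D_(e d) ('D_(e b) h') x * 'D_(e c) k' x +
                  'D_(e b) h' x * 'D_(e d) ('D_(e c) k') x))).
  move=> sh' sk'; apply: eq_bigr => a _; apply: eq_bigr => d _.
  by rewrite derive_structure_bracket.
rewrite !E //.
apply: (@jacobi_second_order _ _ _ (fun b c d => 'D_(e d) (S b c) x) Santi SJ
  (fun a => 'D_(e a) f x) (fun a => 'D_(e a) h x) (fun a => 'D_(e a) k x)
  (fun a b => 'D_(e b) ('D_(e a) f) x) (fun a b => 'D_(e b) ('D_(e a) h) x)
  (fun a b => 'D_(e b) ('D_(e a) k) x)) => a b; exact: sym.
Qed.

End StructureMatrix.

(** * The coordinate identities for the block matrix *)

Section Semidirect.
Context {R : realType} {r p : nat}.
Notation Z := 'rV[R]_p.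
Notation E := 'rV[R]_r.
Context (M : set Z) (oM : open M) (Psi : Z -> 'M[R]_(p, r)).
Context (C : 'I_r -> 'I_r -> 'I_r -> R).
Hypothesis sPsi : forall l k, smooth_on M (fun z => Psi z l k).
Hypothesis C_anti : forall i j k, C i j k = - C j i k.
Hypothesis C_jacobi : forall i j k n,
  \sum_m (C i m n * C j k m + C j m n * C k i m + C k m n * C i j m) = 0.
Hypothesis C_Psi : forall i j l z, M z ->
  \sum_m (Psi z m j * 'D_(delta_mx 0 m) (fun y => Psi y l i) z -
          Psi z m i * 'D_(delta_mx 0 m) (fun y => Psi y l j) z) =
  \sum_k C i j k * Psi z l k.

Definition poisson_matrix_of (xi : E) : 'M[R]_r :=
  \matrix_(i, j) \sum_k C i j k * xi 0 k.

(** With [Psi] equal to the matrix of infinitesimals, or to its opposite, this is the matrix for a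
    left, or a right, action. *)
Definition semidirect_matrix (x : Z * E) : 'M[R]_(p + r) :=
  block_mx 0 (Psi x.1) (- (Psi x.1)^T) (poisson_matrix_of x.2).

Definition semidirect_dir (a : 'I_(p + r)) : Z * E :=
  match fintype.split a with
  | inl l => (delta_mx 0 l, 0)
  | inr k => (0, delta_mx 0 k)
  end.

Let S a b (x : Z * E) := semidirect_matrix x a b.
Let U : set (Z * E) := M `*` setT.

Let blockE := (@block_mxEul R p r p r, @block_mxEur R p r p r,
  @block_mxEdl R p r p r, @block_mxEdr R p r p r).

Lemma semidirect_dirl l : semidirect_dir (lshift r l) = (delta_mx 0 l, 0).
Proof.
rewrite /semidirect_dir; case: split_ordP => j /eqP.
  by rewrite eq_lshift => /eqP ->.
by rewrite eq_lrshift.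
Qed.

Lemma semidirect_dirr k : semidirect_dir (rshift p k) = (0, delta_mx 0 k).
Proof.
rewrite /semidirect_dir; case: split_ordP => j /eqP.
  by rewrite eq_rlshift.
by rewrite eq_rshift => /eqP ->.
Qed.

Let SEll l l' : S (lshift r l) (lshift r l') = cst 0.
Proof. by apply/funext => x; rewrite /S blockE mxE. Qed.

Let SElr l k : S (lshift r l) (rshift p k) = fun x => Psi x.1 l k.
Proof. by apply/funext => x; rewrite /S blockE. Qed.

Let SErl l k : S (rshift p k) (lshift r l) = fun x => - Psi x.1 l k.
Proof. by apply/funext => x; rewrite /S blockE !mxE. Qed.

Let SErr i j : S (rshift p i) (rshift p j) =
  fun x => \sum_k C i j k * x.2 0 k.
Proof. by apply/funext => x; rewrite /S blockE mxE. Qed.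

Lemma semidirect_anti a b x : S a b x = - S b a x.
Proof.
case: (split_ordP a) => [l ->|i ->]; case: (split_ordP b) => [l' ->|j ->].
- by rewrite !SEll oppr0.
- by rewrite SElr SErl opprK.
- by rewrite SElr SErl.
- by rewrite !SErr -sumrN; apply: eq_bigr => k _; rewrite C_anti mulNr.
Qed.

Lemma open_setXT : open U.
Proof.
rewrite openE => -[z xi] [/= Mz _].
have nz : \forall x \near (z, xi), M x.1.
  by apply: cvg_fst; apply: open_nbhs_nbhs.
by near=> x; split => //=; near: x.
Unshelve. all: by end_near. Qed.

Lemma smooth_semidirect a b : smooth_on U (S a b).
Proof.
have oU := open_setXT.
have slr l k : smooth_on U (fun x : Z * E => Psi x.1 l k).
  move=> n; apply: (@class_C_precomp _ _ _ _ _ M _ fst (fun z => Psi z l k)).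
  - by move=> x; apply: (@linear_differentiable _ _ _ fst) => -[? ?]; exact: cvg_fst.
  - by move=> w; exists w.1.
  - by move=> x [].
  - exact: sPsi.
case: (split_ordP a) => [l ->|i ->]; case: (split_ordP b) => [l' ->|j ->].
- by rewrite SEll => n; exact: class_C_cst.
- by rewrite SElr.
- rewrite SErl => n.
  rewrite (_ : (fun x => _) = fun x : Z * E => cst (-1) x * Psi x.1 l' i).
    by apply: class_C_mul => //; [exact: class_C_cst|exact: slr].
  by apply/funext => x; rewrite mulN1r.
- rewrite SErr => n; apply: class_C_sum => // k _.
  apply: (@class_C_mul _ _ _ _ (cst (C i j k))) => //; first exact: class_C_cst.
  apply: (@class_C_precomp _ _ _ _ _ setT _ snd (fun y : E => y 0 k)).
  - by move=> x; apply: (@linear_differentiable _ _ _ snd) => -[? ?]; exact: cvg_snd.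
  - by move=> w; exists w.2.
  - by [].
  - by apply: smooth_on_coord; exact: openT.
Qed.

Lemma derivel_semidirect m a b x : M x.1 ->
  'D_(semidirect_dir (lshift r m)) (S a b) x =
  (block_mx 0 (\matrix_(l, k) 'D_(delta_mx 0 m) (fun z => Psi z l k) x.1)
    (\matrix_(k, l) (- 'D_(delta_mx 0 m) (fun z => Psi z l k) x.1)) 0
    : 'M[R]_(p + r)) a b.
Proof.
rewrite semidirect_dirl => Mx.
have dlr l k : 'D_(delta_mx 0 m, 0) (fun y : Z * E => Psi y.1 l k) x =
    'D_(delta_mx 0 m) (fun z => Psi z l k) x.1.
  exact: (@derive_precomp _ _ _ _ fst (fun z => Psi z l k)).
case: (split_ordP a) => [l ->|i ->]; case: (split_ordP b) => [l' ->|j ->].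
- by rewrite blockE SEll derive_cst mxE.
- by rewrite blockE SElr dlr mxE.
- rewrite blockE SErl mxE -dlr.
  apply: (@deriveN _ _ _ (fun y : Z * E => Psi y.1 l' i)).
  apply: diff_derivable; rewrite -SElr; apply: smooth_onP (smooth_semidirect _ _) _.
  by split.
- rewrite blockE SErr mxE.
  rewrite (@derive_precomp _ _ _ _ snd (fun y : E => \sum_k C i j k * y 0 k) _ _ 0).
    by rewrite derive0.
  by move=> h.
Qed.

Lemma deriver_semidirect m a b x : M x.1 ->
  'D_(semidirect_dir (rshift p m)) (S a b) x =
  (block_mx 0 0 0 (\matrix_(i, j) C i j m) : 'M[R]_(p + r)) a b.
Proof.
rewrite semidirect_dirr => Mx.
have dlr l k : 'D_(0, delta_mx 0 m) (fun y : Z * E => Psi y.1 l k) x = 0.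
  rewrite (@derive_precomp _ _ _ _ fst (fun z => Psi z l k) _ _ 0).
    by rewrite derive0.
  by move=> h.
case: (split_ordP a) => [l ->|i ->]; case: (split_ordP b) => [l' ->|j ->].
- by rewrite blockE SEll derive_cst mxE.
- by rewrite blockE SElr dlr mxE.
- rewrite blockE SErl mxE -[RHS]oppr0 -(dlr l' i).
  apply: (@deriveN _ _ _ (fun y : Z * E => Psi y.1 l' i)).
  apply: diff_derivable; rewrite -SElr; apply: smooth_onP (smooth_semidirect _ _) _.
  by split.
- rewrite blockE SErr mxE.
  rewrite (@derive_precomp _ _ _ _ snd (fun y : E => \sum_k C i j k * y 0 k) _ _
    (delta_mx 0 m)) //.
  have dc k : differentiable (fun y : E => y 0 k) x.2 by exact: differentiable_coord.
  rewrite derive_sumfun; last first.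
    by move=> k; apply: differentiableM => //; exact: differentiable_cst.
  rewrite (bigD1 m) //= big1 ?addr0; last first.
    move=> k km; rewrite derive_cstmul // derive_coord // derive_id mxE.
    by rewrite (negbTE km) andbF mulr0.
  by rewrite derive_cstmul // derive_coord // derive_id mxE !eqxx mulr1.
Qed.

(** The double bracket of the coordinate functions with indices [a], [b], [c]. *)
Let J a b c x := \sum_d S a d x * 'D_(semidirect_dir d) (S b c) x.

Let JE a b c x : M x.1 -> J a b c x =
  \sum_m S a (lshift r m) x *
    (block_mx 0 (\matrix_(l, k) 'D_(delta_mx 0 m) (fun z => Psi z l k) x.1)
      (\matrix_(k, l) (- 'D_(delta_mx 0 m) (fun z => Psi z l k) x.1)) 0
      : 'M[R]_(p + r)) b c +
  \sum_m S a (rshift p m) x *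
    (block_mx 0 0 0 (\matrix_(i, j) C i j m) : 'M[R]_(p + r)) b c.
Proof.
move=> Mx; rewrite /J big_split_ord /=; congr (_ + _); apply: eq_bigr => m _.
  by rewrite derivel_semidirect.
by rewrite deriver_semidirect.
Qed.

Let J_ll a l l' x : M x.1 -> J a (lshift r l) (lshift r l') x = 0.
Proof.
move=> Mx; rewrite JE // !big1 ?addr0 // => m _;
  by rewrite blockE mxE mulr0.
Qed.

Let J_llr l l' k x : M x.1 -> J (lshift r l) (lshift r l') (rshift p k) x = 0.
Proof.
move=> Mx; rewrite JE // !big1 ?addr0 // => m _.
  by rewrite blockE mxE mulr0.
by rewrite SEll mul0r.
Qed.

Let J_lrl l l' k x : M x.1 -> J (lshift r l) (rshift p k) (lshift r l') x = 0.
Proof.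
move=> Mx; rewrite JE // !big1 ?addr0 // => m _.
  by rewrite blockE mxE mulr0.
by rewrite SEll mul0r.
Qed.

Let J_lrr l i j x : M x.1 -> J (lshift r l) (rshift p i) (rshift p j) x =
  \sum_k C i j k * Psi x.1 l k.
Proof.
move=> Mx; rewrite JE // big1 ?add0r => [|m _]; last first.
  by rewrite SEll mul0r.
by apply: eq_bigr => k _; rewrite SElr blockE mxE mulrC.
Qed.

Let J_rlr l i j x : M x.1 -> J (rshift p i) (lshift r l) (rshift p j) x =
  - \sum_m Psi x.1 m i * 'D_(delta_mx 0 m) (fun z => Psi z l j) x.1.
Proof.
move=> Mx; rewrite JE // [X in _ + X]big1 ?addr0 => [|m _]; last first.
  by rewrite blockE mxE mulr0.
by rewrite -sumrN; apply: eq_bigr => m _; rewrite SErl blockE mxE mulNr.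
Qed.

Let J_rrl l i j x : M x.1 -> J (rshift p i) (rshift p j) (lshift r l) x =
  \sum_m Psi x.1 m i * 'D_(delta_mx 0 m) (fun z => Psi z l j) x.1.
Proof.
move=> Mx; rewrite JE // [X in _ + X]big1 ?addr0 => [|m _]; last first.
  by rewrite blockE mxE mulr0.
by apply: eq_bigr => m _; rewrite SErl blockE mxE mulrNN.
Qed.

Let J_rrr i j k x : M x.1 -> J (rshift p i) (rshift p j) (rshift p k) x =
  \sum_n x.2 0 n * \sum_m C i m n * C j k m.
Proof.
move=> Mx; rewrite JE // big1 ?add0r => [|m _]; last first.
  by rewrite blockE mxE mulr0.
under [RHS]eq_bigr do rewrite mulr_sumr.
rewrite exchange_big; apply: eq_bigr => m _; rewrite SErr blockE mxE mulr_suml.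
by apply: eq_bigr => n _; rewrite mulrAC mulrC mulrA.
Qed.

(** For one coordinate of [z] and two of [xi], the Jacobi identity is the commutator formula
    [C_Psi]. *)
Let J_mixed i j l x : M x.1 ->
  J (lshift r l) (rshift p i) (rshift p j) x +
  J (rshift p i) (rshift p j) (lshift r l) x +
  J (rshift p j) (lshift r l) (rshift p i) x = 0.
Proof.
move=> Mx; rewrite J_lrr // J_rrl // J_rlr // -C_Psi // sumrB.
by rewrite subrK subrr.
Qed.

(** Cases by the number of [z] coordinates among the three: with two or three, every term vanishes;
    with one, it is [J_mixed] up to rotation; with none, it is the Jacobi identity of the structure
    constants. *)
Lemma semidirect_jacobi a b c x : M x.1 ->
  \sum_d (S a d x * 'D_(semidirect_dir d) (S b c) x +
     S b d x * 'D_(semidirect_dir d) (S c a) x +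
     S c d x * 'D_(semidirect_dir d) (S a b) x) = 0.
Proof.
move=> Mx; rewrite !big_split /= -/(J a b c x) -/(J b c a x) -/(J c a b x).
case: (split_ordP a) => [l ->|i ->]; case: (split_ordP b) => [l' ->|j ->];
  case: (split_ordP c) => [l'' ->|k ->].
- by rewrite !J_ll // !addr0.
- by rewrite J_llr // J_lrl // J_ll // !addr0.
- by rewrite J_llr // J_lrl // J_ll // !addr0.
- exact: J_mixed.
- by rewrite J_llr // J_lrl // J_ll // !addr0.
- by rewrite -addrA addrC J_mixed.
- by rewrite addrC addrA J_mixed.
- rewrite !J_rrr // -!big_split /= big1 // => n _.
  by rewrite -!mulrDr -!big_split /= C_jacobi mulr0.
Qed.

End Semidirect.

(** * Transport to functions on the product with the dual of the Lie algebra *)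

Section SemidirectPoisson.
Context {R : realType} {r p : nat} (v : r.-tuple 'rV[R]_r).
Hypothesis hv : basis_of fullv v.
Notation Z := 'rV[R]_p.
Notation E := 'rV[R]_r.
Notation phase := (Z * lie_dual R r)%type.
Context (M : set Z) (oM : open M) (Psi : Z -> 'M[R]_(p, r)).
Context (C : 'I_r -> 'I_r -> 'I_r -> R).
Hypothesis sPsi : forall l k, smooth_on M (fun z => Psi z l k).
Hypothesis C_anti : forall i j k, C i j k = - C j i k.
Hypothesis C_jacobi : forall i j k n,
  \sum_m (C i m n * C j k m + C j m n * C k i m + C k m n * C i j m) = 0.
Hypothesis C_Psi : forall i j l z, M z ->
  \sum_m (Psi z m j * 'D_(delta_mx 0 m) (fun y => Psi y l i) z -
          Psi z m i * 'D_(delta_mx 0 m) (fun y => Psi y l j) z) =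
  \sum_k C i j k * Psi z l k.

Let coords (x : phase) : Z * E := (x.1, dual_coords v x.2).
Let S a b (x : Z * E) := semidirect_matrix Psi C x a b.
Let U : set (Z * E) := M `*` setT.
Let oU : open U := open_setXT oM.
Let sbr := structure_bracket (@semidirect_dir R r p) S.
Let br := matrix_bracket v (fun x : phase => semidirect_matrix Psi C (coords x)).

Lemma in_coordsK (F : phase -> R) x : in_coords v F (coords x) = F x.
Proof. by case: x => z t; rewrite /in_coords /= dual_coordsK. Qed.

Lemma grad_rowE (F : phase -> R) x a :
  row_mx (grad_z v F x)^T (grad_xi v F x)^T 0 a =
  'D_(semidirect_dir a) (in_coords v F) (coords x).
Proof.
case: (split_ordP a) => [l ->|k ->].
  by rewrite row_mxEl !mxE semidirect_dirl.
by rewrite row_mxEr !mxE semidirect_dirr.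
Qed.

Lemma matrix_bracketE (F H : phase -> R) x :
  br F H x = sbr (in_coords v F) (in_coords v H) (coords x).
Proof.
rewrite /br /matrix_bracket mxE /sbr /structure_bracket exchange_big.
apply: eq_bigr => b _; rewrite mxE mulr_suml; apply: eq_bigr => a _.
have -> : col_mx (grad_z v H x) (grad_xi v H x) b 0 =
    'D_(semidirect_dir b) (in_coords v H) (coords x).
  by rewrite -grad_rowE -tr_col_mx [RHS]mxE.
by rewrite grad_rowE /S mulrAC mulrC mulrA.
Qed.

(** An equality of functions on the whole coordinate space, so that the inner bracket of a nested
    one, which gets differentiated, can be rewritten. *)
Lemma in_coords_matrix_bracket (F H : phase -> R) :
  in_coords v (br F H) = sbr (in_coords v F) (in_coords v H).
Proof.
apply/funext => -[z xi]; rewrite {1}/in_coords matrix_bracketE.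
by rewrite /coords /= dual_of_coordsK.
Qed.

Let Ucoords x : (M `*` [set: lie_dual R r]) x -> U (coords x).
Proof. by case=> Mx _; split. Qed.

Lemma semidirect_poisson :
  is_poisson_bracket (M `*` setT) (smooth_functions v M) br.
Proof.
have sS a b : smooth_on U (S a b) by exact: smooth_semidirect.
split.
- move=> F H sF sH; rewrite /smooth_functions /= in_coords_matrix_bracket.
  exact: smooth_structure_bracket.
- move=> F F' H H' sF sF' sH sH' FF' HH' x Dx; rewrite !matrix_bracketE.
  have in_U K K' : (forall x, (M `*` setT) x -> K x = K' x) ->
      {in U, in_coords v K =1 in_coords v K'}.
    by move=> KK' -[z xi]; rewrite inE /in_coords => -[Mz _]; exact: KK'.
  apply: (@structure_bracket_ext _ _ _ U); first exact: oU.
  - exact: Ucoords Dx.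
  - exact: in_U FF'.
  - exact: in_U HH'.
- move=> a F K H sF sK sH x Dx; rewrite !matrix_bracketE.
  apply: structure_bracket_linearl; [exact: smooth_onP sF (Ucoords Dx)|].
  exact: smooth_onP sK (Ucoords Dx).
(* Linearity on the right is reduced to linearity on the left by skew symmetry. *)
- move=> a F H K sF sH sK x Dx; rewrite !matrix_bracketE.
  have anti g h : sbr g h (coords x) = - sbr h g (coords x).
    by apply: structure_bracket_anti => b d; exact: semidirect_anti.
  have lin : sbr (in_coords v (fun y => a * H y + K y)) (in_coords v F) (coords x) =
      a * sbr (in_coords v H) (in_coords v F) (coords x) +
      sbr (in_coords v K) (in_coords v F) (coords x).
    apply: structure_bracket_linearl; first exact: smooth_onP sH (Ucoords Dx).
    exact: smooth_onP sK (Ucoords Dx).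
  by rewrite anti lin opprD -mulrN -!anti.
- move=> F H _ _ x Dx; rewrite !matrix_bracketE.
  by apply: structure_bracket_anti => b d; exact: semidirect_anti.
- move=> F H K sF sH sK x Dx; rewrite !matrix_bracketE !in_coords_matrix_bracket.
  apply: (structure_bracket_jacobi oU sS sF sH sK (Ucoords Dx)).
    by move=> a b; exact: semidirect_anti.
  by move=> a b d; apply: semidirect_jacobi => //; case: Dx.
- move=> F H K sF sH sK x Dx; rewrite !matrix_bracketE.
  rewrite -(in_coordsK K x) -(in_coordsK H x).
  apply: structure_bracket_leibniz; first exact: smooth_onP sH (Ucoords Dx).
  exact: smooth_onP sK (Ucoords Dx).
Qed.

End SemidirectPoisson.

(** * Structure constants of a bracket in a basis *)

Lemma linear_sum_scale (K : pzRingType) (V W : lmodType K) (phi : V -> W)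
    (I : Type) (s : seq I) (a : I -> K) (e : I -> V) : linear phi ->
  phi (\sum_(i <- s) a i *: e i) = \sum_(i <- s) a i *: phi (e i).
Proof.
(* Packing [phi] with its proof of linearity gives access to [linear_sum] and [linearZ]. *)
move=> lin; pose f : {linear V -> W} :=
  HB.pack phi (GRing.isLinear.Build _ _ _ _ _ lin).
have : f (\sum_(i <- s) a i *: e i) = \sum_(i <- s) a i *: f (e i).
  by rewrite linear_sum; apply: eq_bigr => i _; rewrite linearZ.
by [].
Qed.

Section StructureConstants.
Context {K : fieldType} {V : vectType K} {r : nat} (v : r.-tuple V).
Hypothesis hv : basis_of fullv v.
Context (b : V -> V -> V).
Hypothesis b_anti : forall x y, b x y = - b y x.
Hypothesis b_linear : forall x, linear (b x).
Hypothesis b_jacobi : forall x y z, b x (b y z) + b y (b z x) + b z (b x y) = 0.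

Definition structure_constant i j k : K := coord v k (b (tnth v i) (tnth v j)).

Lemma basis_expand (w : V) : w = \sum_k coord v k w *: tnth v k.
Proof.
rewrite [LHS](coord_basis hv (memvf w)).
by apply: eq_bigr => k _; rewrite (tnth_nth 0).
Qed.

Lemma structure_constant_anti i j k :
  structure_constant i j k = - structure_constant j i k.
Proof. by rewrite /structure_constant b_anti linearN. Qed.

(** Expanding the inner bracket in the basis turns each quadratic sum into the [n]-th coordinate of
    a nested bracket of basis vectors. *)
Lemma structure_constant_jacobi i j k n :
  \sum_m (structure_constant i m n * structure_constant j k m +
          structure_constant j m n * structure_constant k i m +
          structure_constant k m n * structure_constant i j m) = 0.
Proof.
have E i' j' k' : \sum_m structure_constant i' m n * structure_constant j' k' m =
    coord v n (b (tnth v i') (b (tnth v j') (tnth v k'))).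
  rewrite [X in b _ X]basis_expand (linear_sum_scale _ _ _ (b_linear _)).
  rewrite linear_sum; apply: eq_bigr => m _; rewrite linearZ; exact: mulrC.
by rewrite !big_split /= !E -!linearD b_jacobi linear0.
Qed.

End StructureConstants.

(** * The matrix of infinitesimals, read in the chart *)

Section Infinitesimals.
Context {R : realType} {r p : nat} {G : lieGroupType R r} (c : chart R r G).
Hypothesis hc : chart_at_unit c.
Context (exp : 'rV[R]_r -> G).
Hypothesis hexp : is_exponential c exp.
Context (M : set 'rV[R]_p).
Hypothesis oM : open M.
Context (act : G -> 'rV[R]_p -> 'rV[R]_p).
Hypothesis sact : smooth_action M act.
Hypothesis act1 : forall z, M z -> act 1%g z = z.
Context (v : r.-tuple 'rV[R]_r).
Hypothesis hv : basis_of fullv v.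
Notation E := 'rV[R]_r.
Notation Z := 'rV[R]_p.
Let e0 := chart_unit c.

Definition chart_act (xz : E * Z) : Z := act (chart_inv c xz.1) xz.2.

Let O : set (E * Z) := chart_img c `*` M.

Lemma smooth_chart_act : smooth_on O chart_act.
Proof. by apply: sact; case: hc. Qed.

Lemma open_chart_act_dom : open O.
Proof.
rewrite openE => -[x z] [/= cx Mz].
have nx : \forall xz \near (x, z), chart_img c xz.1.
  by apply: cvg_fst; apply: near_chart_img.
have nz : \forall xz \near (x, z), M xz.2.
  by apply: cvg_snd; apply: open_nbhs_nbhs.
by near=> xz; split; near: xz.
Unshelve. all: by end_near. Qed.

Lemma chart_act_unit z : M z -> chart_act (e0, z) = z.
Proof. by move=> Mz; rewrite /chart_act /= chart_inv_unit // act1. Qed.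

Lemma chart_act_dom z : M z -> O (e0, z).
Proof. by move=> Mz; split => //=; exact: chart_img_unit. Qed.

Local Notation T := (lie_derivative e0 chart_act).

(** The chain rule replaces the curve [exp (t *: tnth v k)] by its velocity at the unit, the basis
    vector itself. *)
Lemma infinitesimalsE z l k : M z ->
  infinitesimals exp act v z l k = T (tnth v k) (fun y : Z => y 0 l) z.
Proof.
move=> Mz; rewrite mxE derive1E.
pose F (x : E) := chart_act (x, z) 0 l.
have -> : 'D_1 (fun t : R => act (exp (t *: tnth v k)) z 0 l) 0 =
    'D_1 (fun t : R => F (chart_exp c exp (tnth v k) t)) (0 : R).
  (* The exponential stays in the domain of the chart for small [t], which suffices for a derivative
     at 0. *)
  apply: near_eq_derive.
  have nd := near_exp_chart_dom hc hexp (tnth v k).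
  near=> t; rewrite /F /chart_act /= /chart_exp chart_mapK //.
  by near: t.
rewrite (derive_chart_exp_comp hexp); last first.
  apply: (@smooth_onP _ _ _ (chart_img c)); last exact: chart_img_unit.
  apply: (@smooth_slicel _ _ _ _ O _ (fun xz => chart_act xz 0 l)) => //.
  move=> n; apply: class_C_coord; first exact: open_chart_act_dom.
  exact: smooth_chart_act.
exact: (derive_slicel (fun xz => chart_act xz 0 l)).
Unshelve. all: by end_near. Qed.

Lemma smooth_infinitesimals l k :
  smooth_on M (fun z => infinitesimals exp act v z l k).
Proof.
move=> n; apply: (@class_C_ext _ _ _ _ _ (T (tnth v k) (fun y : Z => y 0 l))) => //.
  by move=> z; rewrite inE => Mz; rewrite infinitesimalsE.
move: n; apply: (@smooth_lie_derivative _ _ _ _ _ O).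
- exact: open_chart_act_dom.
- exact: oM.
- exact: chart_act_dom.
- exact: smooth_chart_act.
- exact: chart_act_unit.
- exact: smooth_on_coord.
Qed.

Lemma lie_derivative_act k (f : Z -> R) z : M z -> differentiable f z ->
  T (tnth v k) f z = \sum_m infinitesimals exp act v z m k *
    'D_(delta_mx 0 m) f z.
Proof.
move=> Mz df.
rewrite (lie_derivativeE chart_act_dom smooth_chart_act chart_act_unit) //.
rewrite [X in 'D_X f z]row_sum_delta derive_sum_dir //.
apply: eq_bigr => m _; rewrite infinitesimalsE // /lie_derivative derive_coord //.
exact: smooth_onP smooth_chart_act (chart_act_dom Mz).
Qed.

(** The commutator formula is applied to the [l]-th coordinate function and its right-hand side is
    expanded in the basis. For a left action [beta] will be [b], for a right action its opposite. *)
Lemma infinitesimals_bracket (beta : E -> E -> E) :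
  (forall u w (f : Z -> R) z, smooth_on M f -> M z ->
    T w (T u f) z - T u (T w f) z = T (beta u w) f z) ->
  forall i j l z, M z ->
  \sum_m (infinitesimals exp act v z m j *
            'D_(delta_mx 0 m) (fun y => infinitesimals exp act v y l i) z -
          infinitesimals exp act v z m i *
            'D_(delta_mx 0 m) (fun y => infinitesimals exp act v y l j) z) =
  \sum_k coord v k (beta (tnth v i) (tnth v j)) *
    infinitesimals exp act v z l k.
Proof.
move=> comm i j l z Mz; pose f (y : Z) := y 0 l.
have sf : smooth_on M f by exact: smooth_on_coord.
have step a b : \sum_m infinitesimals exp act v z m b *
      'D_(delta_mx 0 m) (fun y => infinitesimals exp act v y l a) z =
    T (tnth v b) (T (tnth v a) f) z.
  rewrite lie_derivative_act //; last first.
    apply: (smooth_onP _ Mz).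
    apply: (@smooth_lie_derivative _ _ _ _ _ O) => //.
    - exact: open_chart_act_dom.
    - exact: chart_act_dom.
    - exact: smooth_chart_act.
    - exact: chart_act_unit.
  apply: eq_bigr => m _; congr (_ * _).
  apply: (open_eq_derive _ oM _ Mz) => y; rewrite inE => My.
  exact: infinitesimalsE.
rewrite sumrB !step comm // [X in T X](basis_expand hv).
pose X w := T w f z.
have linX : linear (X : E -> R^o).
  move=> a x y; apply: (lie_derivative_linear chart_act_dom smooth_chart_act
    chart_act_unit _ _ _ Mz).
  exact: smooth_onP sf Mz.
rewrite -/(X _) (linear_sum_scale _ _ _ linX).
by apply: eq_bigr => k _; rewrite infinitesimalsE.
Qed.

End Infinitesimals.

(** * Commutator formulas for left and right actions *)

Section Commutators.
Context {R : realType} {r p : nat} {G : lieGroupType R r} (c : chart R r G).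
Hypothesis hc : chart_at_unit c.
Context (M : set 'rV[R]_p).
Hypothesis oM : open M.
Context (act : G -> 'rV[R]_p -> 'rV[R]_p).
Notation E := 'rV[R]_r.
Notation Z := 'rV[R]_p.
Let e0 := chart_unit c.
Local Notation T := (lie_derivative e0 (chart_act c act)).

(** The local action law follows from the global one as soon as the product [xy] lies in the
    chart. *)
Lemma left_action_commutator u w (f : Z -> R) z : left_action M act ->
  smooth_on M f -> M z ->
  T w (T u f) z - T u (T w f) z = T (chart_bracket c u w) f z.
Proof.
case=> Mact sact act1 actA.
apply: (@lie_derivative_commutator _ _ _ _ _ (chart_mul_dom c) _
  (chart_img c `*` M)).
- exact: open_chart_mul_dom.
- exact: chart_mul_dom_unit.
- exact: smooth_chart_mul.
- near=> x; apply: chart_mulr => //; near: x.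
  exact/near_chart_img/chart_img_unit.
- near=> x; apply: chart_mull => //; near: x.
  exact/near_chart_img/chart_img_unit.
- exact: open_chart_act_dom.
- exact: oM.
- exact: chart_act_dom.
- exact: smooth_chart_act.
- exact: chart_act_unit.
- move=> z' Mz'; near=> x.
  have cx : chart_img c x.
    by near: x; apply: near_chart_img; exact: chart_img_unit.
  near=> y.
  have Nxy : chart_mul_dom c (x, y).
    near: y; apply: (@near_slicer _ _ (chart_mul_dom c)).
    exact/near_chart_mul_dom/chart_mul_domr.
  by rewrite /chart_act /= chart_inv_mul //= actA.
Unshelve. all: by end_near. Qed.

Let mul_op (xy : E * E) := chart_mul c (xy.2, xy.1).

(** Exchanging the two variables of the law exchanges the components of each direction; Schwarz then
    restores the order of differentiation. *)
Lemma second_order_op u w :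
  second_order e0 mul_op u w = second_order_mul c w u.
Proof.
apply/rowP => i; apply: etrans (esym (second_order_mulC hc w u i)).
rewrite [LHS]mxE.
pose F (xy : E * E) := chart_mul c xy 0 i; pose sw (xy : E * E) := (xy.2, xy.1).
have D1 (H : E * E -> R) a b x : 'D_(a, b) (fun y => H (sw y)) x = 'D_(b, a) H (sw x).
  exact: (@derive_precomp _ _ _ _ sw H).
have -> : 'D_(0, w) (fun xy => mul_op xy 0 i) = fun y => 'D_(w, 0) F (sw y).
  by apply/funext => y; rewrite -D1.
exact: D1.
Qed.

(** In the chart a right action is a left action of the opposite law [mul_op], whose antisymmetrised
    second derivative is [- b]. *)
Lemma right_action_commutator u w (f : Z -> R) z : right_action M act ->
  smooth_on M f -> M z ->
  T w (T u f) z - T u (T w f) z = T (- chart_bracket c u w) f z.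
Proof.
case=> Mact sact act1 actA sf Mz.
have -> : - chart_bracket c u w =
    second_order e0 mul_op u w - second_order e0 mul_op w u.
  by rewrite !second_order_op opprB.
have dsw x : differentiable (fun xy : E * E => (xy.2, xy.1)) x.
  apply: differentiable_pair.
    by apply: (@linear_differentiable _ _ _ snd) => -[? ?]; exact: cvg_snd.
  by apply: (@linear_differentiable _ _ _ fst) => -[? ?]; exact: cvg_fst.
apply: (@lie_derivative_commutator _ _ _ _ _
  [set xy | chart_mul_dom c (xy.2, xy.1)] _ (chart_img c `*` M)).
- have := @open_preimage_on _ _ _ setT (chart_mul_dom c)
    (fun xy : E * E => (xy.2, xy.1)) openT (@open_chart_mul_dom _ _ _ c).
  rewrite setTI; apply => x _; exact: differentiable_continuous.
- exact: chart_mul_dom_unit.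
- move=> n.
  apply: (@class_C_precomp _ _ _ _ _ (chart_mul_dom c) _
    (fun xy : E * E => (xy.2, xy.1)) (chart_mul c)) => //.
  + by move=> [a b]; exists (b, a).
  + exact: smooth_chart_mul.
- near=> x; apply: chart_mull => //; near: x.
  exact/near_chart_img/chart_img_unit.
- near=> x; apply: chart_mulr => //; near: x.
  exact/near_chart_img/chart_img_unit.
- exact: open_chart_act_dom.
- exact: oM.
- exact: chart_act_dom.
- exact: smooth_chart_act.
- exact: chart_act_unit.
- move=> z' Mz'; near=> x.
  have cx : chart_img c x.
    by near: x; apply: near_chart_img; exact: chart_img_unit.
  near=> y.
  have Nxy : chart_mul_dom c (y, x).
    near: y; apply: (@near_slicel _ _ (chart_mul_dom c)).
    exact/near_chart_mul_dom/chart_mul_doml.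
  by rewrite /chart_act /mul_op /= chart_inv_mul //= actA.
- exact: sf.
- exact: Mz.
Unshelve. all: by end_near. Qed.

End Commutators.

(** The common form of the two halves of the theorem: what depends on the side of the action is
    confined to the choice of [Psi] and the proof of its commutator identity. *)
Lemma infinitesimal_bracket_poisson (R : realType) (r p : nat) (G : lieGroupType R r)
    (c : chart R r G) (hc : chart_at_unit c)
    (exp : 'rV[R]_r -> G) (hexp : is_exponential c exp)
    (M : set 'rV[R]_p) (hM : open M)
    (v : r.-tuple 'rV[R]_r) (hv : basis_of fullv v)
    (Psi : 'rV[R]_p -> 'M[R]_(p, r)) :
  (forall l k, smooth_on M (fun z => Psi z l k)) ->
  (forall i j l z, M z ->
    \sum_m (Psi z m j * 'D_(delta_mx 0 m) (fun y => Psi y l i) z -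
            Psi z m i * 'D_(delta_mx 0 m) (fun y => Psi y l j) z) =
    \sum_k coord v k (chart_bracket c (tnth v i) (tnth v j)) * Psi z l k) ->
  is_poisson_bracket (M `*` setT) (smooth_functions v M)
    (matrix_bracket v (fun x => block_mx 0 (Psi x.1) (- (Psi x.1)^T)
      (lie_poisson_matrix c exp v x.2))).
Proof.
move=> sPsi Psi_bracket.
have := @semidirect_poisson R r p v hv M hM Psi
  (structure_constant v (chart_bracket c)) sPsi
  (structure_constant_anti _ (chart_bracket_anti c))
  (structure_constant_jacobi hv (chart_bracket_linearr hc)
    (chart_bracket_jacobi hc)) Psi_bracket.
(* The two matrices differ only in the lower right block, where [chart_bracket] has to be identified
   with [lie_bracket]. *)
congr is_poisson_bracket; congr matrix_bracket; apply/funext => x.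
rewrite /semidirect_matrix; congr block_mx.
apply/matrixP => i j; rewrite !mxE; apply: eq_bigr => k _.
by rewrite (lie_bracketE hc hexp).
Qed.

Theorem theorem2p14 (R : realType) (r p : nat) (G : lieGroupType R r)
    (c : chart R r G) (hc : chart_at_unit c)
    (exp : 'rV[R]_r -> G) (hexp : is_exponential c exp)
    (M : set 'rV[R]_p) (hM : open M)
    (act : G -> 'rV[R]_p -> 'rV[R]_p)
    (v : r.-tuple 'rV[R]_r) (hv : basis_of fullv v) :
  (left_action M act ->
   is_poisson_bracket (M `*` setT) (smooth_functions v M)
     (matrix_bracket v (fun x =>
        block_mx 0 (infinitesimals exp act v x.1)
                 (- (infinitesimals exp act v x.1)^T)
                 (lie_poisson_matrix c exp v x.2)))) /\
  (right_action M act ->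
   is_poisson_bracket (M `*` setT) (smooth_functions v M)
     (matrix_bracket v (fun x =>
        block_mx 0 (- infinitesimals exp act v x.1)
                 (infinitesimals exp act v x.1)^T
                 (lie_poisson_matrix c exp v x.2)))).
Proof.
split=> hact; have [_ sact act1 _] := hact.
  apply: (infinitesimal_bracket_poisson hc hexp hM hv).
    exact: (smooth_infinitesimals hc hexp hM sact act1).
  apply: (infinitesimals_bracket hc hexp hM sact act1 hv) => u w f z.
  exact: left_action_commutator.
(* The lower left block is rewritten as a double opposite, so that the matrix takes the common form
   with [Psi] the opposite of the infinitesimals. *)
have -> : (fun x : 'rV[R]_p * lie_dual R r =>
      block_mx 0 (- infinitesimals exp act v x.1)
        (infinitesimals exp act v x.1)^T (lie_poisson_matrix c exp v x.2)) =
    (fun x => block_mx 0 (- infinitesimals exp act v x.1)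
        (- (- infinitesimals exp act v x.1)^T) (lie_poisson_matrix c exp v x.2)).
  by apply/funext => x; rewrite [(- _)^T]raddfN opprK.
have dinf l k z : M z ->
    differentiable (fun z => infinitesimals exp act v z l k) z.
  by apply: smooth_onP; exact: (smooth_infinitesimals hc hexp hM sact act1).
have oppE (B : 'M[R]_(p, r)) l k : (- B) l k = - B l k by rewrite mxE.
have oppfE l k : (fun z => (- infinitesimals exp act v z) l k) =
    fun z => - 1 * infinitesimals exp act v z l k.
  by apply/funext => z; rewrite oppE mulN1r.
have dopp l k u z : M z -> 'D_u (fun z => (- infinitesimals exp act v z) l k) z =
    - 'D_u (fun z => infinitesimals exp act v z l k) z.
  by move=> Mz; rewrite oppfE (derive_cstmul _ _ (dinf _ _ _ Mz)) mulN1r.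
apply: (infinitesimal_bracket_poisson hc hexp hM hv
  (Psi := fun z => - infinitesimals exp act v z)).
  move=> l k n; rewrite oppfE.
  apply: (@class_C_mul _ _ _ _ (cst (-1))) => //; first exact: class_C_cst.
  exact: (smooth_infinitesimals hc hexp hM sact act1).
move=> i j l z Mz.
have := infinitesimals_bracket hc hexp hM sact act1 hv
  (fun u w f z => @right_action_commutator _ _ _ _ _ hc _ hM _ u w f z hact) i j l Mz.
(* The left side is quadratic in the infinitesimals and does not see the sign of [Psi]; on the right
   the sign moves from the bracket to the infinitesimals. *)
move=> E; apply: etrans (etrans _ E) _; apply: eq_bigr => k _.
  by rewrite !oppE !dopp // !mulrNN.
by rewrite linearN oppE mulrN mulNr.
Qed.
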